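(* There exists a solution $u:\mathbb{R}^6\to\mathbb{R}^6$ of the Ginzburg–Landau system $$\Delta u=u(|u|^2-1)\quad\text{on }\mathbb{R}^6$$ satisfying (i) $|u(x)|\to1$ as $|x|\to\infty$; (ii) $\deg(u,\infty)=1$, which is not, modulo translation and isometry, of the form $u(x)=\frac{x}{|x|}h(|x|)$ with $h:\mathbb{R}_+\to\mathbb{R}_+$ a smooth function such that $h(0)=0$ and $h(\infty)=1$. Furthermore, $u$ is a radial solution, i.e. it can be written as $$u(x)=\Phi\left(\frac{x}{|x|}\right)h(|x|),$$ where $\Phi=\frac14\nabla F$ is the gradient map of the isoparametric polynomial $F$ on $\mathbb{R}^6$ with $g=4$, $m_1=m_2=1$, and $h\in C^2(\mathbb{R}_+,\mathbb{R})$ is the unique solution of $$\begin{cases}-h''-5\dfrac{h'}{r}+21\dfrac{h}{r^2}=h(1-h^2),\quad r>0,\\[4pt] h(0)=0,\qquad h(\infty)=1.\end{cases}$$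
   Context: $\mathbb{R}_+=[0,\infty)$, and $h(\infty)$ denotes $\lim_{r\to\infty}h(r)$. $\deg(u,\infty)$: for a continuous $u:\mathbb{R}^N\to\mathbb{R}^N$ with $|u(x)|\to1$ as $|x|\to\infty$, it is the Brouwer degree of the map $S^{N-1}\to S^{N-1}$, $\omega\mapsto u(R\omega)/|u(R\omega)|$, for all sufficiently large $R$. ''Not of the form $\frac{x}{|x|}h(|x|)$ modulo translation and isometry'' means that there are no $x_0\in\mathbb{R}^6$, $A\in O(6)$ and $h$ as described such that $u(x)=A\,\frac{x-x_0}{|x-x_0|}\,h(|x-x_0|)$ for all $x\neq x_0$. The isoparametric polynomial on $\mathbb{R}^6$ with $g=4$, $m_1=m_2=1$ is the homogeneous degree-4 polynomial associated (via Cartan–Münzner theory) with the isoparametric hypersurfaces (hypersurfaces with constant principal curvatures) of $S^5$ having $g=4$ distinct principal curvatures, all of multiplicity $1$; it is unique up to isometries of $\mathbb{R}^6$, and is given explicitly by $$F(x,y)=(|x|^2+|y|^2)^2-2\{(|x|^2-|y|^2)^2+4\langle x,y\rangle^2\},\qquad (x,y)\in\mathbb{R}^3\times\mathbb{R}^3,$$ where $\langle\cdot,\cdot\rangle$ is the Euclidean inner product of $\mathbb{R}^3$. It satisfies $|\nabla F|^2=16|z|^6$ and $\Delta F=0$ for $z=(x,y)\in\mathbb{R}^6$, so $\Phi=\frac14\nabla F$ maps $S^5$ to $S^5$. *)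

(* Defs.v *)
From HB Require Import structures.
From mathcomp Require Import all_boot all_order all_algebra.
From mathcomp Require Import all_classical all_reals all_analysis.
Set Implicit Arguments.
Unset Strict Implicit.
Unset Printing Implicit Defensive.
Import Order.TTheory GRing.Theory Num.Theory.
Import numFieldNormedType.Exports.
Local Open Scope classical_set_scope.
Local Open Scope ring_scope.

(* Points of R^n are row vectors.  The library norm on 'rV[R]_n is the sup norm,
   so the Euclidean one is defined here; the two induce the same topology. *)

Definition dotp (R : realType) (n : nat) (x y : 'rV[R]_n) : R :=
  \sum_i x 0 i * y 0 i.

Definition enorm (R : realType) (n : nat) (x : 'rV[R]_n) : R :=
  Num.sqrt (dotp x x).

(* x / |x|, with value 0 at x = 0 *)
Definition normalize (R : realType) (n : nat) (x : 'rV[R]_n) : 'rV[R]_n :=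
  (enorm x)^-1 *: x.

Definition sphere (R : realType) (n : nat) : set 'rV[R]_n :=
  [set x | enorm x = 1].

Definition partial (R : realType) (n : nat) (W : normedModType R) (i : 'I_n)
    (f : 'rV[R]_n -> W) (x : 'rV[R]_n) : W :=
  'D_(delta_mx 0 i) f x.

Definition gradient (R : realType) (n : nat) (f : 'rV[R]_n -> R)
    (x : 'rV[R]_n) : 'rV[R]_n :=
  \row_i partial i f x.

Definition laplacian (R : realType) (n : nat) (W : normedModType R)
    (f : 'rV[R]_n -> W) (x : 'rV[R]_n) : W :=
  \sum_(i < n) partial i (partial i f) x.

(* C^k regularity on A; A is meant to be open *)
Fixpoint Ck (R : realType) (n : nat) (W : normedModType R) (k : nat)
    (A : set 'rV[R]_n) (f : 'rV[R]_n -> W) : Prop :=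
  match k with
  | 0 => forall x, A x -> {for x, continuous f}
  | k'.+1 => forall i : 'I_n,
      (forall x, A x -> derivable f x (delta_mx 0 i)) /\ Ck k' A (partial i f)
  end.

Definition half_line (R : realType) : set R := [set r : R | 0 <= r].

(* h1 is the derivative of h on [0, oo), one-sided at 0 *)
Definition half_line_derivative (R : realType) (h h1 : R -> R) : Prop :=
  forall r : R, 0 <= r ->
    (h s - h r) / (s - r) @[s --> within (@half_line R) r^'] --> h1 r.

(* h is C^k on [0, oo), up to and including 0; the values of h on the negative
   reals are irrelevant *)
Fixpoint half_line_Ck (R : realType) (k : nat) (h : R -> R) : Prop :=
  {within @half_line R, continuous h} /\
  match k with
  | 0 => True
  | k'.+1 => exists h1 : R -> R,
      half_line_derivative h h1 /\ half_line_Ck k' h1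
  end.

Definition half_line_smooth (R : realType) (h : R -> R) : Prop :=
  forall k : nat, half_line_Ck k h.

Definition sphere_homotopic (R : realType) (n : nat)
    (f g : 'rV[R]_n -> 'rV[R]_n) : Prop :=
  exists H : R * 'rV[R]_n -> 'rV[R]_n,
  [/\ {within `[0, 1] `*` @sphere R n, continuous H},
      forall t w, 0 <= t <= 1 -> sphere w -> sphere (H (t, w)),
      forall w, sphere w -> H (0, w) = f w
    & forall w, sphere w -> H (1, w) = g w].

(* Extension of a map of the unit sphere, homogeneous of degree 1. *)
Definition cone (R : realType) (n : nat) (g : 'rV[R]_n -> 'rV[R]_n)
    (x : 'rV[R]_n) : 'rV[R]_n :=
  enorm x *: g (normalize x).

(* At a point x of the sphere the differential of cone g sends the outward
   normal x to the outward normal g x, and restricts to dg_x on the tangent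
   space at x.  Hence its determinant is that of dg_x in oriented orthonormal
   bases of the tangent spaces at x and g x: it vanishes iff x is critical for
   g, and its sign is the local degree of g at x otherwise. *)
Definition cone_jacobian (R : realType) (n : nat) (g : 'rV[R]_n -> 'rV[R]_n)
    (x : 'rV[R]_n) : R :=
  \det ('J (cone g) x).

Definition sphere_C1 (R : realType) (n : nat) (g : 'rV[R]_n -> 'rV[R]_n) : Prop :=
  (forall w, sphere w -> sphere (g w)) /\ Ck 1 [set x | x != 0] (cone g).

Definition regular_value (R : realType) (n : nat) (g : 'rV[R]_n -> 'rV[R]_n)
    (y : 'rV[R]_n) : Prop :=
  sphere y /\ forall x, sphere x -> g x = y -> cone_jacobian g x != 0.

(* Brouwer degree of a continuous self-map f of the unit sphere: the number of
   preimages of a regular value, counted with orientation signs, of a C^1 map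
   homotopic to f.  It does not depend on the choice of that map nor of the
   regular value.  The preimage of a regular value is finite, since the sphere
   is compact. *)
Definition brouwer_degree (R : realType) (n : nat) (f : 'rV[R]_n -> 'rV[R]_n)
    (d : int) : Prop :=
  exists (g : 'rV[R]_n -> 'rV[R]_n) (y : 'rV[R]_n),
  [/\ sphere_homotopic f g, sphere_C1 g, regular_value g y,
      finite_set [set x | sphere x /\ g x = y]
    & \sum_(x \in [set x | sphere x /\ g x = y]) sgz (cone_jacobian g x) = d].

Definition degree_at_infinity (R : realType) (n : nat)
    (u : 'rV[R]_n -> 'rV[R]_n) (d : int) : Prop :=
  \forall r \near +oo, brouwer_degree (fun w => normalize (u (r *: w))) d.

Definition norm_tends_to_1 (R : realType) (n : nat)
    (u : 'rV[R]_n -> 'rV[R]_n) : Prop :=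
  forall e : R, 0 < e ->
    \forall r \near +oo, forall x, r <= enorm x -> `|enorm (u x) - 1| < e.

(* classical solutions *)
Definition ginzburg_landau (R : realType) (n : nat)
    (u : 'rV[R]_n -> 'rV[R]_n) : Prop :=
  Ck 2 setT u /\ forall x, laplacian u x = (enorm (u x) ^+ 2 - 1) *: u x.

(* As the coordinates are rows, an isometry A acts by x |-> x *m A. *)
Definition standard_form (R : realType) (n : nat)
    (u : 'rV[R]_n -> 'rV[R]_n) : Prop :=
  exists (x0 : 'rV[R]_n) (A : 'M[R]_n) (h : R -> R),
  [/\ A *m A^T = 1%:M,
      half_line_smooth h,
      forall r, 0 <= r -> 0 <= h r,
      h 0 = 0 /\ h r @[r --> +oo] --> (1 : R)
    & forall x, x != x0 ->
        u x = h (enorm (x - x0)) *: (normalize (x - x0) *m A)].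

(* isoparametric polynomial with g = 4, m1 = m2 = 1; the two halves of
   z : R^3 x R^3 are x and y *)
Definition isoparam (R : realType) (z : 'rV[R]_(3 + 3)) : R :=
  let x := lsubmx z in
  let y := rsubmx z in
  (enorm x ^+ 2 + enorm y ^+ 2) ^+ 2
  - 2 * ((enorm x ^+ 2 - enorm y ^+ 2) ^+ 2 + 4 * dotp x y ^+ 2).

Definition isoparam_gradient_map (R : realType) (z : 'rV[R]_6) : 'rV[R]_6 :=
  4^-1 *: gradient (@isoparam R) z.

Definition radial_profile (R : realType) (h : R -> R) : Prop :=
  [/\ half_line_Ck 2 h,
      forall r, 0 < r ->
        - derive1n 2 h r - 5 * (derive1 h r / r) + 21 * (h r / r ^+ 2)
        = h r * (1 - h r ^+ 2),
      h 0 = 0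
    & h r @[r --> +oo] --> (1 : R)].

(* Main.v *)
Require Import Defs.
From HB Require Import structures.
From mathcomp Require Import all_boot all_order all_algebra.
From mathcomp Require Import all_classical all_reals all_analysis.
From mathcomp Require Import ring lra.
Import Order.TTheory GRing.Theory Num.Theory.
Import numFieldNormedType.Exports.
Local Open Scope ring_scope.
Local Open Scope classical_set_scope.
Set Implicit Arguments.
Unset Strict Implicit.
Unset Printing Implicit Defensive.

(* With x = (x', x'') in R^3 x R^3 and the quadratic forms N = |x|^2,
   q = |x'|^2 - |x''|^2, p = 2 <x', x''>, one has F = N^2 - 2 (q^2 + p^2), and
   Phi = grad F / 4 is a harmonic cubic map with |Phi|^2 = N^3.  Hence u = G(N) Phi
   solves the Ginzburg-Landau system as soon as t G'' + 6 G' = - G (1 - t^3 G^2) / 4,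
   where h(r) = r^3 G(r^2).

   Existence of G.  The function (t + c)^(-3/2) is a supersolution for c = 7 and a
   subsolution for c = 36.  After adding (t + 6) G to both sides the nonlinearity is
   monotone and the linear part annihilates e^t, so that it is inverted by two
   successive integrations, from 0 and from infinity; written in x = ln t they become
   integrations of continuous functions over half-lines.  The supremum of the
   subsolutions is then a fixed point, as in the Knaster-Tarski theorem.

   Uniqueness of h.  For two profiles, r^5 (k' h - h' k) has derivative
   r^5 h k (k^2 - h^2), which forces k <= h if h > 0.  A profile with a zero is
   compared with its own reflection at its last zero, which gives a contradiction.

   Degree.  A generic point of the circle of S^5 in the plane of the first and fifth
   coordinates has exactly three preimages under Phi, all in the same plane, with
   local degrees 1, 1, -1.

   Phi is not linear on the sphere, so u is not of the standard form. *)

(** * Differentiation *)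

(** The coefficient 21 is 3 (3 + 4), so 3 is the growing exponent of the radial equation at the
    singular point r = 0. It is also the degree of Phi, which is why dividing h by r^3 leaves a
    factor G that stays bounded there.

    Near t = 0 only bounds on G, G' and t G'' are known, and G has no prescribed value at 0. The C^2
    regularity of u at the origin therefore comes from the third-order vanishing of Phi, not from
    smoothness of G.

    The constants 7 and 36 are forced by the two ends. For h(r) = (r^2 / (r^2 + c))^(3/2), c = 7
    reproduces the expansion 1 - 21 / (2 r^2) of a profile at infinity, and c = 36 the relation 24
    G'(0) = - G(0) imposed by the equation at t = 0.

    In the uniqueness part a competing profile has no prescribed sign, while the comparison divides
    by one of the two profiles. This is why positivity has to be proved for every profile. *)

Section Derivatives.
Variables (R : realType) (V : normedModType R).
Implicit Types (f g : V -> R) (x v : V).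

Lemma dcst (c : R) x v : is_derive x v (fun _ : V => c) 0.
Proof. exact: is_derive_cst. Qed.

Lemma dadd f g x v a b : is_derive x v f a -> is_derive x v g b ->
  is_derive x v (fun y => f y + g y) (a + b).
Proof. by move=> ? ?; exact: is_deriveD. Qed.

Lemma dopp f x v a : is_derive x v f a -> is_derive x v (fun y => - f y) (- a).
Proof. by move=> ?; exact: is_deriveN. Qed.

Lemma dmul f g x v a b : is_derive x v f a -> is_derive x v g b ->
  is_derive x v (fun y => f y * g y) (f x * b + g x * a).
Proof. by move=> ? ?; exact: is_deriveM. Qed.

Lemma dexp f n x v a : is_derive x v f a ->
  is_derive x v (fun y => f y ^+ n) (n%:R * f x ^+ n.-1 * a).
Proof.
move=> df; rewrite [X in is_derive _ _ X _](_ : _ = f ^+ n); last first.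
  by apply/funext => y; rewrite exprfctE.
exact: is_deriveX.
Qed.

Lemma dinv f x v a : f x != 0 -> is_derive x v f a ->
  is_derive x v (fun y => (f y)^-1) (- (f x) ^- 2 * a).
Proof.
move=> fx0 [df <-]; split; first exact: derivableV.
by rewrite deriveV.
Qed.

(** A directional derivative only sees the restriction to a line. This yields the chain rule [dcomp]
    for an outer function of one variable without asking [f] to be Frechet differentiable. *)
Lemma is_derive_line (W : normedModType R) (f : V -> W) x v d :
  is_derive x v f d <-> is_derive 0 (1 : R) (fun t => f (t *: v + x)) d.
Proof.
have E : 'D_v f x = 'D_1 (fun t : R => f (t *: v + x)) 0.
  rewrite /derive; set g1 := fun h => h^-1 *: _; set g2 := fun h => h^-1 *: _.
  suff -> : g1 = g2 by [].
  by rewrite funeqE /g1 /g2 => h /=; rewrite addr0 scale0r add0r [_%:A]mulr1.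
split=> -[df <-]; first by split; [exact: (derivable1P f x v).1 df | rewrite E].
by split; [exact: (derivable1P f x v).2 df | rewrite E].
Qed.

Lemma dcomp (phi : R -> R) f x v a b : is_derive (f x) 1 phi a ->
  is_derive x v f b -> is_derive x v (fun y => phi (f y)) (a * b).
Proof.
move=> dphi /is_derive_line df; apply/is_derive_line.
by apply: (@is_derive1_comp _ phi (fun t => f (t *: v + x))); rewrite ?scale0r ?add0r.
Qed.

End Derivatives.

Lemma dcoord (R : realType) n (i : 'I_n) (x v : 'rV[R]_n) :
  is_derive x v (fun y : 'rV[R]_n => y 0 i) (v 0 i).
Proof.
apply/is_derive_line; rewrite (_ : (fun _ => _) = fun t : R => t * v 0 i + x 0 i).
  have := dadd (dmul (is_derive_id (0 : R) 1) (dcst (v 0 i) (0 : R) 1)) (dcst (x 0 i) (0 : R) 1).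
  by rewrite mulr0 add0r mulr1 addr0.
by apply/funext => t; rewrite !mxE.
Qed.

(** Derivatives known in the context serve as rules, so that [der] differentiates expressions in
    unknown functions. What remains is the nonvanishing of inverted factors and an identity between
    two forms of the derivative. *)
Ltac der_step :=
  lazymatch goal with
  | H : is_derive _ _ ?f _ |- is_derive _ _ ?f _ => exact: H
  | H : forall x : _, is_derive x _ ?f _ |- is_derive _ _ ?f _ => exact: H
  | |- is_derive _ _ (@expR _) _ => exact: is_derive_expR
  | |- is_derive _ _ (fun y => fun_of_matrix y 0 _) _ => exact: dcoord
  | |- is_derive _ _ -%R _ => exact: is_deriveNid
  | |- is_derive _ _ (@GRing.inv _) _ =>
      eapply (@dinv _ _ (fun y => y)); [|exact: is_derive_id]
  | |- is_derive _ _ ( *%R ?c) _ =>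
      eapply (@dmul _ _ (fun _ => c) (fun y => y)); [exact: dcst|exact: is_derive_id]
  | |- is_derive _ _ (fun y => y) _ => exact: is_derive_id
  | |- is_derive _ _ (fun _ => ?c) _ => exact: dcst
  | |- is_derive _ _ (fun y => @?f y + @?g y) _ => eapply dadd
  | |- is_derive _ _ (fun y => - (@?f y)) _ => eapply dopp
  | |- is_derive _ _ (fun y => (@?f y) * (@?g y)) _ => eapply dmul
  | |- is_derive _ _ (fun y => (@?f y) ^+ ?n) _ => eapply dexp
  | |- is_derive _ _ (fun y => (@?f y)^-1) _ => eapply dinv
  | |- is_derive _ _ (fun y => expR (@?f y)) _ =>
      eapply (@dcomp _ _ (@expR _)); [exact: is_derive_expR|]
  | H : forall x : _, is_derive x _ ?f _ |- is_derive _ _ (fun y => ?f (@?g y)) _ =>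
      first [ solve [apply: H] | eapply (@dcomp _ _ f); [apply: H|] ]
  | H : is_derive _ _ ?f _ |- is_derive _ _ (fun y => ?f (@?g y)) _ =>
      eapply (@dcomp _ _ f); [exact: H|]
  end.

Ltac der := eapply is_derive_eq; [repeat der_step|].

(** * Mean value arguments and primitives on the real line *)

Section RealFunctions.
Variable R : realType.
Implicit Types (f df g k : R -> R) (a b x t : R).

Lemma is_derive_continuous f x d : is_derive x 1 f d -> {for x, continuous f}.
Proof. by case=> /derivable1_diffP /differentiable_continuous. Qed.

Lemma mean_value f df a b : a < b ->
  (forall x, a <= x <= b -> is_derive x 1 f (df x)) ->
  exists c, a < c < b /\ f b - f a = df c * (b - a).
Proof.
move=> ab d; have [|c|c] := @MVT _ f df a b ab.
- by move=> x; rewrite in_itv /= => /andP[/ltW ax /ltW xb]; apply: d; rewrite ax.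
- apply: derivable_within_continuous => x; rewrite in_itv /= => xab.
  by have [] := d x xab.
- by rewrite in_itv /= => cab E; exists c.
Qed.

Lemma ndecr_derive f df a b : a <= b ->
  (forall x, a <= x <= b -> is_derive x 1 f (df x)) ->
  (forall x, a < x < b -> 0 <= df x) -> f a <= f b.
Proof.
rewrite le_eqVlt => /predU1P[-> //|ab] d d0; rewrite -subr_ge0.
have [c [cab ->]] := mean_value ab d.
by rewrite mulr_ge0 ?d0// subr_ge0 ltW.
Qed.

Lemma constant_derive f a b :
  (forall x, Num.min a b <= x <= Num.max a b -> is_derive x 1 f 0) -> f a = f b.
Proof.
wlog ab : a b / a <= b => [H d|].
  have [/H|ba] := leP a b; first exact.
  by apply/esym/H; [exact: ltW | rewrite minC maxC].
rewrite (min_idPl ab) (max_idPr ab) => d.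
apply/le_anti/andP; split; first exact: (ndecr_derive ab d).
rewrite -lerN2; apply: (@ndecr_derive (fun x => - f x) (fun _ => - 0) a b ab).
  by move=> x /d ?; exact: dopp.
by move=> x _; rewrite oppr0.
Qed.

Local Lemma primitive_on (f : R -> R) (A : R) : continuous f ->
  exists F, forall x, `|x| < A -> is_derive x 1 F (f x).
Proof.
move=> fc; pose mu := @lebesgue_measure R.
exists (fun x => (\int[mu]_(t in [set` `[- A, x]]) (f t))%R).
move=> x; rewrite ltr_norml => /andP[Ax xA].
have fi : mu.-integrable `[- A, A] (EFin \o f).
  apply: continuous_compact_integrable; first exact: segment_compact.
  exact: continuous_subspaceT.
have [? <-] := continuous_FTC1_closed xA fi Ax (fc x).
by rewrite derive1E; exact/derivableP.
Qed.

(** Primitives on the intervals ]-A, A[, normalised to vanish at 0, agree wherever two of them are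
    defined, so the value at x can be read off from the interval of radius |x| + 1. *)
Lemma primitive (f : R -> R) : continuous f ->
  exists F, forall x, is_derive x 1 F (f x).
Proof.
move=> fc.
have /choice[P HP] : forall A : R, exists F, forall x, `|x| < A -> is_derive x 1 F (f x).
  by move=> A; exact: primitive_on.
exists (fun x => P (`|x| + 1) x - P (`|x| + 1) 0) => x.
(* The radius |x| + 2 exceeds |y| + 1 for every y at distance less than 1 from x, so a single
   primitive serves in a neighbourhood of x. *)
pose A := `|x| + 2.
have eqA y : `|y| + 1 < A -> P A y - P A 0 = P (`|y| + 1) y - P (`|y| + 1) 0.
  move=> yA; suff : P A y - P (`|y| + 1) y = P A 0 - P (`|y| + 1) 0 by lra.
  apply: (@constant_derive (fun z => P A z - P (`|y| + 1) z)) => z /andP[z1 z2].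
  have zy : `|z| <= `|y|.
    rewrite ler_norml; apply/andP; split.
      by apply: le_trans z1; rewrite le_min -normrN lerNl ler_norm/= oppr_le0.
    by apply: le_trans z2 _; rewrite ge_max ler_norm/=.
  rewrite -(subrr (f z)); apply: dadd; [|apply: dopp]; apply: HP.
    by apply: le_lt_trans zy _; apply: lt_trans yA; rewrite ltrDl.
  by apply: le_lt_trans zy _; rewrite ltrDl.
apply: (@near_eq_is_derive _ _ _ (fun y => P A y - P A 0)).
  have : \forall y \near x, `|y - x| < 1.
    by apply/(@nbhs_ballP R); exists 1 => //= y; rewrite /ball/= distrC.
  apply: filterS => y yx; apply: eqA; rewrite /A.
  rewrite (_ : 2 = 1 + 1)// addrA ltrD2r; have := ler_normD (y - x) x; rewrite subrK; lra.
rewrite -[f x]addr0; apply: dadd; apply: HP.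
by rewrite /A ltrDl.
Qed.

End RealFunctions.

(** * Integration from minus infinity, and the barriers *)

Section Tails.
Variable R : realType.
Implicit Types (k M B : R -> R).

(* M is the integral of k >= 0 over ]-oo, x] *)
Definition tail_integral k M :=
  [/\ forall x : R, is_derive x 1 M (k x), forall x, 0 <= k x, forall x, 0 <= M x
    & forall e, 0 < e -> exists x, M x < e].

Lemma tail_integral_nd k M x y : tail_integral k M -> x <= y -> M x <= M y.
Proof. by move=> [dM k0 _ _] xy; apply: (ndecr_derive xy). Qed.

(** [M] is any primitive of [k] minus its infimum. The infimum is finite because [B] minus the
    primitive is nondecreasing and [B] is nonnegative, which bounds every increment of the primitive
    ending at y by B y. *)
Lemma tail_integral_exists k B B' : continuous k -> (forall x, 0 <= k x <= B' x) ->
  (forall x : R, is_derive x 1 B (B' x)) -> (forall x, 0 <= B x) ->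
  exists M, tail_integral k M.
Proof.
move=> kc kB dB B0; have [P dP] := primitive kc.
have Pnd x y : x <= y -> P x <= P y.
  by move=> xy; apply: (ndecr_derive xy) => // z _; have /andP[] := kB z.
have PB x y : x <= y -> P y - P x <= B y.
  move=> xy; have H : B x - P x <= B y - P y.
    apply: (@ndecr_derive _ (fun z => B z - P z) (fun z => B' z - k z) x y xy).
    by move=> z _; rewrite subr_ge0; have /andP[] := kB z.
  by have := B0 x; lra.
have Plb : has_inf (range P).
  split; first by exists (P 0), 0.
  exists (P 0 - B 0) => _ [x _ <-]; have [x0|/ltW x0] := leP 0 x.
    by have := Pnd _ _ x0; have := B0 0; lra.
  by have := PB _ _ x0; lra.
have infP x : inf (range P) <= P x by apply: ge_inf; [exact: Plb.2 | exists x].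
exists (fun x => P x - inf (range P)); split.
- by move=> x; der; ring.
- by move=> x; have /andP[] := kB x.
- by move=> x; rewrite subr_ge0.
- move=> e e0; have [_ [x _ <-] H] := inf_adherent e0 Plb.
  by exists x; lra.
Qed.

(** [B - M] is nondecreasing, and far to the left it is almost nonnegative because [M] is small
    there. *)
Lemma tail_integral_le_primitive k M B B' : tail_integral k M ->
  (forall x : R, is_derive x 1 B (B' x)) -> (forall x, k x <= B' x) ->
  (forall x, 0 <= B x) -> forall x, M x <= B x.
Proof.
move=> tM dB kB B0 x; have [dM k0 M0 Minf] := tM.
apply/ler_addgt0Pr => e /Minf[x0 Me].
pose s := Num.min x0 x; have sx : s <= x by rewrite ge_min lexx orbT.
have Ms : M s <= M x0 by apply: (tail_integral_nd tM); rewrite ge_min lexx.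
suff : B s - M s <= B x - M x by have := B0 s; lra.
apply: (@ndecr_derive _ (fun z => B z - M z) (fun z => B' z - k z) s x sx).
by move=> z _; rewrite subr_ge0.
Qed.

Lemma tail_integral_ge k M B B' : tail_integral k M ->
  (forall x : R, is_derive x 1 B (B' x)) -> (forall x, B' x <= k x) ->
  (forall e, 0 < e -> exists x0, forall x, x <= x0 -> B x <= e) ->
  forall x, B x <= M x.
Proof.
move=> [dM k0 M0 _] dB Bk B0 x; apply/ler_addgt0Pr => e /B0[x0 Bx0].
pose s := Num.min x0 x.
have sx : s <= x by rewrite ge_min lexx orbT.
have := Bx0 s; rewrite ge_min lexx => /(_ isT) Bs.
suff : M s - B s <= M x - B x by have := M0 s; lra.
apply: (@ndecr_derive _ (fun z => M z - B z) (fun z => k z - B' z) s x sx).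
by move=> z _; rewrite subr_ge0.
Qed.

Lemma tail_integral_le k1 k2 M1 M2 : tail_integral k1 M1 -> tail_integral k2 M2 ->
  (forall x, k1 x <= k2 x) -> forall x, M1 x <= M2 x.
Proof.
move=> t1 t2 k12; have [dM1 _ _ H] := t1; apply: (tail_integral_ge t2 dM1 k12).
move=> e /H[x0 x0e]; exists x0 => x xx0.
by apply: le_trans (ltW x0e); exact: tail_integral_nd t1 xx0.
Qed.

End Tails.

Section Barrier.
Variable R : realType.
Implicit Types (c x : R).

(** The function (t + c)^(-3/2) in the variable x = ln t. *)
Definition barrier c x : R := expR (- (3 / 2) * ln (expR x + c)).

Lemma barrier_gt0 c x : 0 < barrier c x. Proof. exact: expR_gt0. Qed.

Lemma sqr_barrier c x : 0 <= c -> barrier c x ^+ 2 = ((expR x + c) ^+ 3)^-1.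
Proof.
move=> c0; have t0 : 0 < expR x + c by rewrite ltr_wpDr// expR_gt0.
rewrite /barrier -expRM_natl -[in RHS](lnK (x := expR x + c)) ?posrE//.
by rewrite -expRM_natl -expRN; congr expR; field.
Qed.

Lemma barrier_derive c x : 0 <= c ->
  is_derive x 1 (barrier c) (- (3 / 2) * expR x / (expR x + c) * barrier c x).
Proof.
move=> c0; have t0 : 0 < expR x + c by rewrite ltr_wpDr// expR_gt0.
have := is_derive1_ln t0 => dln.
rewrite /barrier; der.
by rewrite /=; field; exact: lt0r_neq0.
Qed.

Lemma barrier_le1 c x : 1 <= c -> barrier c x <= 1.
Proof.
move=> c1; rewrite -expR0 ler_expR mulNr oppr_le0 mulr_ge0//.
by rewrite ln_ge0// ler_wpDl// expR_ge0.
Qed.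

End Barrier.

(** * The linear problem *)

Section ContinuousArithmetic.
Variables (R : realType) (T : topologicalType).
Implicit Types (f g : T -> R) (x : T).

Lemma ct_cst (a : R) x : continuous_at x (fun _ : T => a).
Proof. exact: cvg_cst. Qed.

Lemma ct_add f g x : continuous_at x f -> continuous_at x g ->
  continuous_at x (fun y => f y + g y).
Proof. exact: cvgD. Qed.

Lemma ct_opp f x : continuous_at x f -> continuous_at x (fun y => - f y).
Proof. exact: cvgN. Qed.

Lemma ct_mul f g x : continuous_at x f -> continuous_at x g ->
  continuous_at x (fun y => f y * g y).
Proof. exact: cvgM. Qed.

Lemma ct_exp f n x : continuous_at x f -> continuous_at x (fun y => f y ^+ n).
Proof.
move=> fc; elim: n => [|n IH]; first exact: ct_cst.
rewrite (_ : (fun _ => _) = fun y => f y * f y ^+ n); first exact: ct_mul.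
by apply/funext => y; rewrite exprS.
Qed.

Lemma ct_inv f x : f x != 0 -> continuous_at x f -> continuous_at x (fun y => (f y)^-1).
Proof. by move=> f0 fc; exact: cvgV f0 fc. Qed.

Lemma ct_norm f x : continuous_at x f -> continuous_at x (fun y => `|f y|).
Proof. exact: cvg_norm. Qed.

Lemma ct_comp (g : R -> R) f x : continuous_at (f x) g -> continuous_at x f ->
  continuous_at x (fun y => g (f y)).
Proof. by move=> gc fc; apply: (@cvg_comp _ _ _ f g _ (nbhs (f x))). Qed.

End ContinuousArithmetic.

Ltac ct_step :=
  lazymatch goal with
  | |- continuous_at _ (fun y => @?f y + @?g y) => apply: ct_add
  | |- continuous_at _ (fun y => - (@?f y)) => apply: ct_opp
  | |- continuous_at _ (fun y => (@?f y) * (@?g y)) => apply: ct_mul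
  | |- continuous_at _ (fun y => (@?f y) ^+ ?n) => apply: ct_exp
  | |- continuous_at _ (@GRing.inv _) => apply: (@ct_inv _ _ (fun y => y)); [|exact: cvg_id]
  | |- continuous_at _ (fun y => (@?f y)^-1) => apply: ct_inv
  | |- continuous_at _ (fun y => `|@?f y|) => apply: ct_norm
  | |- continuous_at _ (fun y => expR (@?f y)) =>
      apply: (@ct_comp _ _ (@expR _)); [exact: continuous_expR|]
  end.

Ltac ct := repeat ct_step; try exact: ct_cst; try by [].

Section Atoms.
Variable R : realType.
Implicit Types f : R -> R.

Lemma cont_reflect f : continuous f -> continuous (fun x => f (- x)).
Proof. by move=> fc x; apply: (@ct_comp _ _ f); [exact: fc|exact: opp_continuous]. Qed.

Lemma derive_cont f df : (forall x : R, is_derive x 1 f (df x)) -> continuous f.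
Proof. by move=> d x; exact: is_derive_continuous (d x). Qed.

End Atoms.

(** * The solution operator of the linear problem, its monotonicity and its barriers *)

Section LinearSolve.
Variable R : realType.
Implicit Types (w y M : R -> R) (c x : R).

Definition admissible w := forall x, barrier 36 x <= w x <= barrier 7 x.

(** Since d/dx = t d/dt, this carries one factor t more than the right-hand side of the equation in
    t, and [weighted] divides by t^5 instead of t^6. *)
Definition source w x : R :=
  expR x ^+ 6 * expR (expR x) *
  ((expR x + 6) * w x + w x * (1 - expR x ^+ 3 * w x ^+ 2) / 4).

Definition weighted M x : R := (expR x ^+ 5)^-1 * (expR (expR x) ^+ 2)^-1 * M x.

Definition damped y x : R := (expR (expR x))^-1 * y x.

(* In the variable t = e^x this says that y is the bounded solution of
   (t^6 e^(2t) (e^(-t) y)')' = - t^5 e^t ((t + 6) w + w (1 - t^3 w^2) / 4),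
   and M is - t^6 e^(2t) (e^(-t) y)'. *)
Definition linear_solution w y := exists M,
  tail_integral (source w) M /\
  tail_integral (fun x => weighted M (- x)) (fun x => damped y (- x)).

(* The value of - t^6 e^(2t) (e^(-t) y)' for y = barrier c, with t = e^x. *)
Definition flux c x : R :=
  expR x ^+ 6 * expR (expR x) * (barrier c x * (1 + 3 / 2 / (expR x + c))).

Definition dflux c x : R :=
  expR x ^+ 6 * expR (expR x) * (barrier c x *
    (6 + expR x + 9 / (expR x + c) - 15 / 4 * expR x / (expR x + c) ^+ 2)).

Lemma expR_addc_gt0 c x : 0 <= c -> 0 < expR x + c.
Proof. by move=> c0; rewrite ltr_wpDr// expR_gt0. Qed.

Lemma flux_derive c x : 0 <= c -> is_derive x 1 (flux c) (dflux c x).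
Proof.
move=> c0; have := barrier_derive x c0 => db.
have tc := expR_addc_gt0 x c0.
rewrite /flux; der; first exact: lt0r_neq0.
by rewrite /dflux /=; field; exact: lt0r_neq0.
Qed.

Lemma damped_barrier_derive c x : 0 <= c ->
  is_derive x 1 (damped (barrier c)) (- weighted (flux c) x).
Proof.
move=> c0; have := barrier_derive x c0 => db.
have tc := expR_addc_gt0 x c0.
have ex := expR_gt0 (expR x); have tx := expR_gt0 x.
rewrite /damped; der; first exact: lt0r_neq0.
by rewrite /weighted /flux /=; field; rewrite ?lt0r_neq0.
Qed.

Lemma admissible_barrier c : 7 <= c <= 36 -> admissible (barrier c).
Proof.
move=> /andP[c7 c36] x; rewrite !ler_expR.
have tx := expR_gt0 x.
have ln_le (a b : R) : 0 < a -> a <= b -> ln a <= ln b.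
  by move=> a0 ab; rewrite ler_ln ?posrE//; apply: lt_le_trans ab.
have H1 : ln (expR x + 7) <= ln (expR x + c) by apply: ln_le; lra.
have H2 : ln (expR x + c) <= ln (expR x + 36) by apply: ln_le; lra.
by apply/andP; split; lra.
Qed.

Lemma admissible_gt0 w x : admissible w -> 0 < w x.
Proof. by move=> /(_ x)/andP[+ _]; apply: lt_le_trans; exact: barrier_gt0. Qed.

Lemma barrier_scaled_lt1 c x : 0 < c -> expR x ^+ 3 * barrier c x ^+ 2 < 1.
Proof.
move=> c0; rewrite sqr_barrier ?ltW// ltr_pdivrMr ?mul1r ?exprn_gt0 ?addr_gt0 ?expR_gt0//.
by have tx := expR_gt0 x; rewrite ltr_pXn2r// ?nnegrE; lra.
Qed.

Lemma admissible_scaled_le1 w x : admissible w -> expR x ^+ 3 * w x ^+ 2 <= 1.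
Proof.
move=> wa; have w0 := admissible_gt0 x wa; have /andP[_ w7] := wa x.
apply: le_trans (ltW (@barrier_scaled_lt1 7 x _)) => //.
rewrite ler_pM2l ?exprn_gt0 ?expR_gt0// ler_sqr//; last exact: ltW (barrier_gt0 _ _).
exact: ltW.
Qed.

Lemma source_ge0 w x : admissible w -> 0 <= source w x.
Proof.
move=> wa; have w0 := admissible_gt0 x wa; have := admissible_scaled_le1 x wa.
have tx := expR_gt0 x; have ex := expR_gt0 (expR x) => H.
apply: mulr_ge0; first by rewrite mulr_ge0 ?exprn_ge0 ?ltW.
by apply: addr_ge0; [rewrite mulr_ge0|rewrite divr_ge0 ?mulr_ge0]; lra.
Qed.

(** The difference quotient of the bracket is t + 6 + (1 - t^3 (a^2 + a b + b^2)) / 4. Below the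
    upper barrier t^3 b^2 <= 1, so the last term is at least -1/2 and the summand t + 6 outweighs
    it. *)
Lemma source_le w1 w2 x : admissible w1 -> admissible w2 -> w1 x <= w2 x ->
  source w1 x <= source w2 x.
Proof.
move=> wa1 wa2 w12; have w10 := admissible_gt0 x wa1.
have := admissible_scaled_le1 x wa2.
have tx := expR_gt0 x; have ex := expR_gt0 (expR x) => H.
have [w20 T0] : 0 < w2 x /\ 0 < expR x ^+ 3.
  by split; [exact: admissible_gt0 | rewrite exprn_gt0].
rewrite ler_pM2l ?mulr_gt0 ?exprn_gt0// -subr_ge0.
set T := expR x ^+ 3 in H T0 *; set a := w1 x in w10 w12 *; set b := w2 x in w20 w12 H *.
have -> : (expR x + 6) * b + b * (1 - T * b ^+ 2) / 4 -
  ((expR x + 6) * a + a * (1 - T * a ^+ 2) / 4) =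
  (b - a) * (expR x + 6 + (1 - T * b ^+ 2 - (T * (a * b) + T * a ^+ 2)) / 4) by field.
apply: mulr_ge0; first lra.
have H1 : T * (a * b) <= T * b ^+ 2.
  by rewrite ler_pM2l// expr2 ler_pM2r.
have H2 : T * a ^+ 2 <= T * b ^+ 2 by rewrite ler_pM2l// ler_sqr; [|exact: ltW..].
lra.
Qed.

(** For a general c, the difference of the two brackets has numerator (21 - 3 c) s^2 + (57 c - 3
    c^2) s + (36 - c) c^2 over 4 (s + c)^3. At c = 7 the leading coefficient vanishes and the others
    are positive; at c = 36, in [source_barrier_sub], the constant one vanishes and the others are
    negative. *)
Lemma source_barrier_super x : source (barrier 7) x <= dflux 7 x.
Proof.
rewrite /source /dflux; have tx := expR_gt0 x; have ex := expR_gt0 (expR x).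
rewrite ler_pM2l ?mulr_gt0 ?exprn_gt0// mulrC -[X in _ + X]mulrA -mulrDr.
rewrite ler_pM2l ?barrier_gt0// sqr_barrier//.
set s := expR x in tx *; rewrite -subr_ge0.
have s7 : 0 < s + 7 by lra.
have -> : 6 + s + 9 / (s + 7) - 15 / 4 * s / (s + 7) ^+ 2 -
  (s + 6 + (1 - s ^+ 3 * ((s + 7) ^+ 3)^-1) / 4) =
  (252 * s + 1421) / (4 * (s + 7) ^+ 3).
  by field; rewrite lt0r_neq0.
apply: divr_ge0; first lra.
by apply: mulr_ge0; [|apply: exprn_ge0]; lra.
Qed.

Lemma source_barrier_sub x : dflux 36 x <= source (barrier 36) x.
Proof.
rewrite /source /dflux; have tx := expR_gt0 x; have ex := expR_gt0 (expR x).
rewrite ler_pM2l ?mulr_gt0 ?exprn_gt0// [(_ + 6) * _]mulrC -[X in _ <= _ + X]mulrA -mulrDr.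
rewrite ler_pM2l ?barrier_gt0// sqr_barrier//.
set s := expR x in tx *; rewrite -subr_ge0.
have s7 : 0 < s + 36 by lra.
have -> : (s + 6 + (1 - s ^+ 3 * ((s + 36) ^+ 3)^-1) / 4) -
  (6 + s + 9 / (s + 36) - 15 / 4 * s / (s + 36) ^+ 2) =
  (87 * s ^+ 2 + 1836 * s) / (4 * (s + 36) ^+ 3).
  by field; rewrite lt0r_neq0.
apply: divr_ge0; first by have := sqr_ge0 s; lra.
by apply: mulr_ge0; [|apply: exprn_ge0]; lra.
Qed.

Lemma weighted_ge0 M x : 0 <= M x -> 0 <= weighted M x.
Proof. by move=> M0; rewrite !mulr_ge0 ?invr_ge0 ?exprn_ge0 ?expR_ge0. Qed.

Lemma weighted_le M1 M2 x : M1 x <= M2 x -> weighted M1 x <= weighted M2 x.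
Proof. by move=> M12; rewrite ler_wpM2l ?mulr_ge0 ?invr_ge0 ?exprn_ge0 ?expR_ge0. Qed.

Lemma damped_le y1 y2 x : (damped y1 x <= damped y2 x) = (y1 x <= y2 x).
Proof. by rewrite ler_pM2l// invr_gt0 expR_gt0. Qed.

Lemma reflect_derive (f df : R -> R) : (forall x : R, is_derive x 1 f (df x)) ->
  forall x : R, is_derive x 1 (fun x => f (- x)) (- df (- x)).
Proof. by move=> d x; der; ring. Qed.

Lemma source_continuous w : continuous w -> continuous (source w).
Proof.
move=> wc x; have := wc x; have := @continuous_expR R x.
by move=> ec {}wc; rewrite /source; ct.
Qed.

Lemma weighted_continuous M : continuous M -> continuous (weighted M).
Proof.
move=> Mc x; have := Mc x; have := @continuous_expR R x.
move=> ec {}Mc; rewrite /weighted; ct.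
by rewrite expf_neq0// lt0r_neq0 ?expR_gt0.
Qed.

Lemma flux_ge0 c x : 0 <= c -> 0 <= flux c x.
Proof.
move=> c0; have := expR_addc_gt0 x c0 => tc.
rewrite !mulr_ge0 ?exprn_ge0 ?expR_ge0//.
by rewrite addr_ge0// divr_ge0// ltW.
Qed.

Lemma flux_at_Ninfty c e : 1 <= c -> 0 < e ->
  exists x0, forall x, x <= x0 -> flux c x <= e.
Proof.
(* For t <= 1 and c >= 1, [K] bounds every factor of the flux except t^6, and t^6 <= t. *)
move=> c1 e0; pose K : R := expR 1 * (1 + 3 / 2).
have K0 : 0 < K by rewrite mulr_gt0 ?expR_gt0.
exists (Num.min 0 (ln (e / K))) => x; rewrite le_min => /andP[x0 xK].
have tx := expR_gt0 x; have t1 : expR x <= 1 by rewrite expR_le1.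
have eK : expR x <= e / K by rewrite -ler_ln ?posrE ?divr_gt0// expRK.
rewrite -(divfK (lt0r_neq0 K0) e) /flux -mulrA; apply: ler_pM.
- by rewrite exprn_ge0// ltW.
- by rewrite !mulr_ge0 ?expR_ge0// addr_ge0 ?divr_ge0 ?addr_ge0 ?ltW//; lra.
- by apply: le_trans eK; rewrite exprS ger_pMr// exprn_ile1// ltW.
apply: ler_pM; first exact: expR_ge0.
- by rewrite mulr_ge0 ?expR_ge0// addr_ge0 ?divr_ge0 ?addr_ge0 ?ltW//; lra.
- by rewrite ler_expR.
rewrite -[leRHS]mul1r; apply: ler_pM; first exact: expR_ge0.
- by rewrite addr_ge0 ?divr_ge0 ?addr_ge0 ?ltW//; lra.
- exact: barrier_le1.
by rewrite lerD2l ler_pdivrMr ?ler_peMr//; lra.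
Qed.

Lemma damped_barrier_at_infty c e : 1 <= c -> 0 < e ->
  exists x0, forall x, x <= x0 -> damped (barrier c) (- x) <= e.
Proof.
move=> c1 e0; exists (ln e) => x; rewrite -ler_expR lnK ?posrE//; apply: le_trans.
have tx := expR_gt0 (- x).
rewrite -[leRHS]mulr1; apply: ler_pM; rewrite ?invr_ge0 ?expR_ge0 ?barrier_le1//.
have -> : expR x = (expR (- x))^-1 by rewrite expRN invrK.
rewrite lef_pV2 ?posrE ?expR_gt0//.
by have := expR_ge1Dx (expR (- x)); lra.
Qed.

Lemma linear_solution_le w1 w2 y1 y2 : admissible w1 -> admissible w2 ->
  linear_solution w1 y1 -> linear_solution w2 y2 -> (forall x, w1 x <= w2 x) ->
  forall x, y1 x <= y2 x.
Proof.
move=> wa1 wa2 [M1 [tM1 tN1]] [M2 [tM2 tN2]] w12 x.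
have M12 := tail_integral_le tM1 tM2 (fun x => source_le wa1 wa2 (w12 x)).
have := tail_integral_le tN1 tN2 (fun x => weighted_le (M12 (- x))) (- x).
by rewrite opprK damped_le.
Qed.

(** Monotonicity puts the source of [w] between those of the two barriers, hence between the
    derivatives of their fluxes; integrating from minus infinity keeps the order. *)
Lemma linear_solution_flux w M : admissible w -> tail_integral (source w) M ->
  forall x, flux 36 x <= M x <= flux 7 x.
Proof.
move=> wa tM x; have a7 : admissible (barrier 7) by apply: admissible_barrier; lra.
have a36 : admissible (barrier 36) by apply: admissible_barrier; lra.
apply/andP; split.
  apply: (tail_integral_ge tM (fun x => @flux_derive 36 x _)) => // [z|e e0].
    apply: le_trans (source_barrier_sub z) _.
    by apply: source_le => //; have /andP[] := wa z.
  by apply: flux_at_Ninfty => //; lra.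
apply: (tail_integral_le_primitive tM (fun x => @flux_derive 7 x _)) => // [z|z].
  apply: le_trans (source_barrier_super z).
  by apply: source_le => //; have /andP[] := wa z.
exact: flux_ge0.
Qed.

(** Both improper integrals converge by domination: the first by the flux of the upper barrier, the
    second by its damped value. *)
Lemma linear_solution_exists w : continuous w -> admissible w ->
  exists y, linear_solution w y.
Proof.
move=> wc wa; have a7 : admissible (barrier 7) by apply: admissible_barrier; lra.
have [//|x|x|x|M tM] := @tail_integral_exists _ (source w) (flux 7) (dflux 7).
- exact: source_continuous.
- rewrite source_ge0//=; apply: le_trans (source_barrier_super x).
  by apply: source_le => //; have /andP[] := wa x.
- exact: flux_derive.
- exact: flux_ge0.
have [dM k0 M0 Minf] := tM.
have M7 x : M x <= flux 7 x by have /andP[] := linear_solution_flux wa tM x.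
have [|x|x|x|N tN] := @tail_integral_exists _ (fun x => weighted M (- x))
    (fun x => damped (barrier 7) (- x)) (fun x => weighted (flux 7) (- x)).
- by apply: cont_reflect; apply: weighted_continuous; exact: derive_cont dM.
- by rewrite weighted_ge0//= weighted_le.
- have := reflect_derive (fun z => damped_barrier_derive z (ler0n R 7)) x.
  by rewrite opprK.
- by rewrite mulr_ge0 ?invr_ge0 ?expR_ge0.
exists (fun x => expR (expR x) * N (- x)); exists M; split => //.
rewrite (_ : (fun x => damped _ _) = N)//; apply/funext => x.
by rewrite /damped opprK mulKf// lt0r_neq0 ?expR_gt0.
Qed.

(** The derivative dy/dx = t y'(t), obtained by solving M = - t^6 e^(2t) (e^(-t) y)' for t y'(t). *)
Definition linear_slope y M x : R :=
  expR x * y x - (expR x ^+ 5 * expR (expR x))^-1 * M x.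

Lemma linear_solution_derive w y M : tail_integral (source w) M ->
  tail_integral (fun x => weighted M (- x)) (fun x => damped y (- x)) ->
  forall x : R, is_derive x 1 y (linear_slope y M x).
Proof.
move=> tM [dN _ _ _] x.
have -> : y = fun x => expR (expR x) * damped y (- - x).
  by apply/funext => z; rewrite opprK /damped mulVKf// lt0r_neq0 ?expR_gt0.
have := reflect_derive dN => {}dN; der.
rewrite /= /damped /weighted /linear_slope !opprK.
have tx := expR_gt0 x; have ex := expR_gt0 (expR x).
by field; rewrite ?lt0r_neq0.
Qed.

(** The last term is what remains of adding (t + 6) times the unknown to both sides; at a fixed
    point w = y it disappears and the equation for G is left, written in x. *)
Lemma linear_slope_derive w y M : tail_integral (source w) M ->
  tail_integral (fun x => weighted M (- x)) (fun x => damped y (- x)) ->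
  forall x : R, is_derive x 1 (linear_slope y M)
    (- 5 * linear_slope y M x - expR x * (w x * (1 - expR x ^+ 3 * w x ^+ 2) / 4)
     - expR x * (expR x + 6) * (w x - y x)).
Proof.
move=> tM tN x; have dy := linear_solution_derive tM tN; have [dM _ _ _] := tM.
have tx := expR_gt0 x; have ex := expR_gt0 (expR x).
rewrite /linear_slope; der.
  by rewrite lt0r_neq0// mulr_gt0// exprn_gt0.
rewrite /= /linear_slope /source.
by field; rewrite ?lt0r_neq0.
Qed.

Lemma linear_solution_bounds w y : admissible w -> linear_solution w y ->
  admissible y.
Proof.
move=> wa [M [tM tN]] x; have MF := linear_solution_flux wa tM.
suff : damped (barrier 36) x <= damped y x <= damped (barrier 7) x.
  by rewrite !damped_le.
apply/andP; split.
  rewrite -[x]opprK; apply: (tail_integral_ge tN (B := fun z => damped (barrier 36) (- z))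
    (B' := fun z => weighted (flux 36) (- z))) => [z|z|e e0].
  - have := reflect_derive (fun z => damped_barrier_derive z (ler0n R 36)) z.
    by rewrite opprK.
  - by apply: weighted_le; have /andP[] := MF (- z).
  - by apply: damped_barrier_at_infty => //; lra.
rewrite -[x]opprK; apply: (tail_integral_le_primitive tN
  (B := fun z => damped (barrier 7) (- z)) (B' := fun z => weighted (flux 7) (- z))) => [z|z|z].
- have := reflect_derive (fun z => damped_barrier_derive z (ler0n R 7)) z.
  by rewrite opprK.
- by apply: weighted_le; have /andP[] := MF (- z).
- by rewrite mulr_ge0 ?invr_ge0 ?expR_ge0.
Qed.

(** The slope is a difference of two nonnegative terms: t y is at most t, and the flux of the upper
    barrier bounds the other by 2 t. The bound does not depend on [w]. *)
Lemma linear_slope_bound w y M x : admissible w -> tail_integral (source w) M ->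
  admissible y -> `|linear_slope y M x| <= 2 * expR x.
Proof.
move=> wa tM ya; have /andP[_ MF] := linear_solution_flux wa tM x.
have [_ _ /(_ x) M0 _] := tM; have tx := expR_gt0 x; have ex := expR_gt0 (expR x).
have y0 := admissible_gt0 x ya; have /andP[_ y7] := ya x.
have b1 : barrier 7 x <= 1 by apply: barrier_le1; lra.
have b0 := barrier_gt0 7 x.
have A0 : 0 <= (expR x ^+ 5 * expR (expR x))^-1 * M x.
  by rewrite mulr_ge0// invr_ge0 mulr_ge0 ?exprn_ge0// ltW.
have A1 : (expR x ^+ 5 * expR (expR x))^-1 * M x <= 2 * expR x.
  rewrite ler_pdivrMl ?mulr_gt0 ?exprn_gt0//; apply: le_trans MF _.
  rewrite /flux (_ : _ * (2 * _) = expR x ^+ 6 * expR (expR x) * 2); last by ring.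
  rewrite ler_pM2l ?mulr_gt0 ?exprn_gt0// -[leRHS]mul1r; apply: ler_pM.
  - exact: ltW.
  - by rewrite addr_ge0 ?divr_ge0//; lra.
  - exact: b1.
  suff : 3 / 2 / (expR x + 7) <= 1 by lra.
  by rewrite ler_pdivrMr; lra.
have ty : expR x * y x <= expR x by rewrite ger_pMr//; lra.
have ty0 : 0 <= expR x * y x by rewrite mulr_ge0// ltW.
by rewrite /linear_slope ler_norml; apply/andP; split; lra.
Qed.

(** The functions 2 e^x + y and 2 e^x - y are nondecreasing. The estimate is uniform in [w] and
    one-sided, a form that passes to suprema. *)
Lemma linear_solution_lipschitz w y a b : admissible w -> linear_solution w y ->
  y a <= y b + 2 * `|expR a - expR b|.
Proof.
move=> wa wy; have ya := linear_solution_bounds wa wy; have [M [tM tN]] := wy.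
have dy := linear_solution_derive tM tN.
have bd x := linear_slope_bound x wa tM ya.
have [ab|/ltW ba] := leP a b.
  have : y a + 2 * expR a <= y b + 2 * expR b.
    apply: (@ndecr_derive _ (fun x => y x + 2 * expR x)
      (fun x => linear_slope y M x + 2 * expR x) a b ab).
    by move=> x _; have := bd x; rewrite ler_norml => /andP[]; lra.
  have : 0 <= expR b - expR a by rewrite subr_ge0 ler_expR.
  by rewrite distrC => /ger0_norm ->; lra.
have : - y b + 2 * expR b <= - y a + 2 * expR a.
  apply: (@ndecr_derive _ (fun x => - y x + 2 * expR x)
    (fun x => - linear_slope y M x + 2 * expR x) b a ba).
  by move=> x _; have := bd x; rewrite ler_norml => /andP[]; lra.
have : 0 <= expR a - expR b by rewrite subr_ge0 ler_expR.
by move=> /ger0_norm ->; lra.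
Qed.

End LinearSolve.

(** * Existence of the radial factor *)

Section RadialFactor.
Variable R : realType.
Implicit Types (w y : R -> R).

Definition subsolution w :=
  [/\ continuous w, admissible w & exists y, linear_solution w y /\ forall x, w x <= y x].

Lemma subsolution_step w y : subsolution w -> linear_solution w y ->
  (forall x, w x <= y x) -> subsolution y.
Proof.
move=> [wc wa _] wy w_y; have ya := linear_solution_bounds wa wy.
have yc : continuous y.
  by have [M [tM tN]] := wy; exact: derive_cont (linear_solution_derive tM tN).
split=> //; have [z yz] := linear_solution_exists yc ya.
by exists z; split=> //; exact: linear_solution_le wy yz w_y.
Qed.

Lemma subsolution_barrier : subsolution (barrier 36).
Proof.
have a36 : admissible (barrier (36 : R)) by apply: admissible_barrier; lra.
have c36 : continuous (barrier (36 : R)).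
  exact: derive_cont (fun x => barrier_derive x (ler0n R 36)).
split=> //; have [y wy] := linear_solution_exists c36 a36.
by exists y; split=> // x; have /andP[] := linear_solution_bounds a36 wy x.
Qed.

(* Knaster-Tarski: the supremum of all subsolutions is a fixed point.  It is
   continuous because it is also the supremum of the images of the subsolutions,
   which share a modulus of continuity. *)
Lemma fixed_point : exists y, admissible y /\ linear_solution y y.
Proof.
pose S x := [set v | exists w, subsolution w /\ v = w x].
pose G x := sup (S x).
have Sne x : S x !=set0 by exists (barrier 36 x), (barrier 36); split=> //; exact: subsolution_barrier.
have Sub x : has_sup (S x).
  split=> //; exists (barrier 7 x) => _ [w [[_ wa _] ->]].
  by have /andP[] := wa x.
have leG w x : subsolution w -> w x <= G x.
  by move=> sw; apply: sup_upper_bound => //; exists w.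
have Ga : admissible G.
  move=> x; rewrite leG/=; last exact: subsolution_barrier.
  apply: (@ge_sup _ (S x)) => // _ [w [[_ wa _] ->]].
  by have /andP[] := wa x.
have GL a b : G a <= G b + 2 * `|expR a - expR b|.
  apply: (@ge_sup _ (S a)) => // _ [w [sw ->]]; have [_ wa [y [wy w_y]]] := sw.
  apply: le_trans (w_y a) _; apply: le_trans (linear_solution_lipschitz a b wa wy) _.
  by rewrite lerD2r leG//; exact: subsolution_step wy w_y.
have Gc : continuous G.
  move=> x; apply/cvgrPdist_le => e e0.
  have /cvgrPdist_le/(_ (e / 2)) := @continuous_expR R x; rewrite divr_gt0// => /(_ isT).
  apply: filterS => z xz; rewrite ler_norml.
  have := GL x z; have := GL z x; rewrite [`|expR z - _|]distrC.
  by move=> H1 H2; apply/andP; split; lra.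
have [y Gy] := linear_solution_exists Gc Ga.
have G_y x : G x <= y x.
  apply: (@ge_sup _ (S x)) => // _ [w [sw ->]]; have [_ wa [z [wz w_z]]] := sw.
  apply: le_trans (w_z x) _; apply: (linear_solution_le wa Ga wz Gy) => v.
  exact: leG.
have sG : subsolution G by split=> //; exists y.
(* Since G <= y, the image of [G] is itself a subsolution and cannot exceed the supremum. *)
have yG : y = G.
  by apply/funext => x; apply/le_anti; rewrite G_y andbT leG//; exact: subsolution_step Gy G_y.
by exists G; split=> //; rewrite -{2}yG.
Qed.

(* In terms of the profile h, this is h(r) = r^3 G(r^2), and G1 = G'. *)
Definition radial_factor (G G1 : R -> R) := forall t : R, 0 < t ->
  [/\ is_derive t 1 G (G1 t),
      is_derive t 1 G1 ((- 6 * G1 t - G t * (1 - t ^+ 3 * G t ^+ 2) / 4) / t),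
      0 < G t <= 1,
      (t / (t + 36)) ^+ 3 <= t ^+ 3 * G t ^+ 2 <= 1
    & `|G1 t| <= 2].

Lemma radial_factor_exists : exists G G1 : R -> R, radial_factor G G1.
Proof.
have [y [ya [M [tM tN]]]] := fixed_point.
have dy := linear_solution_derive tM tN; have dy1 := linear_slope_derive tM tN.
have bd x := linear_slope_bound x ya tM ya.
pose G t := y (ln t); pose G1 t := linear_slope y M (ln t) / t.
exists G, G1 => t t0; have dln := is_derive1_ln t0; have t0' := lt0r_neq0 t0.
have lt : expR (ln t) = t by rewrite lnK ?posrE.
split.
- by rewrite /G; der; rewrite /G1.
- rewrite /G1; der; first exact: t0'.
  by rewrite /= /G1 /G lt; field.
- apply/andP; split; first exact: (admissible_gt0 (ln t) ya).
  have /andP[_ y7] := ya (ln t).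
  by apply: le_trans y7 _; apply: barrier_le1; lra.
- apply/andP; split; last by have := admissible_scaled_le1 (ln t) ya; rewrite lt.
  have /andP[y36 _] := ya (ln t).
  rewrite expr_div_n ler_pM2l ?exprn_gt0// -[in leLHS]lt -sqr_barrier//.
  by rewrite ler_sqr ?nnegrE; [|exact: ltW (barrier_gt0 _ _)|exact: ltW (admissible_gt0 _ ya)].
- by rewrite /G1 normrM normfV (gtr0_norm t0) ler_pdivrMr//; have := bd (ln t); rewrite lt.
Qed.

End RadialFactor.

(** * Monotonicity arguments *)

Section RealFunctionsMore.
Variable R : realType.
Implicit Types (f df g : R -> R) (a b c x : R).

Lemma near_gt f c m d : is_derive c 1 f d -> m < f c ->
  exists2 e, 0 < e & forall x, `|x - c| < e -> m < f x.
Proof.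
move=> /is_derive_continuous fc mc.
have /cvgrPdist_lt/(_ (f c - m)) := fc; rewrite subr_gt0 => /(_ mc).
move=> /(@nbhs_ballP R)[e /= e0 H]; exists e => // x xc.
have := H x; rewrite /ball/= distrC => /(_ xc); rewrite ltr_norml => /andP[]; lra.
Qed.

Lemma derive_gt0_right f c d : is_derive c 1 f d -> 0 < d ->
  exists2 e, 0 < e & forall x, c < x < c + e -> f c < f x.
Proof.
move=> [fd <-]; rewrite /derive => d0.
have /cvgrPdist_lt/(_ ('D_1 f c)) := fd; rewrite /derive => /(_ d0).
move=> /(@nbhs_ballP R)[e /= e0 H]; exists e => // x /andP[cx xe].
have := H (x - c); rewrite /ball/= sub0r normrN gtr0_norm ?subr_gt0//.
have xc0 : x - c != 0 by rewrite subr_eq0 gt_eqF.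
have xce : x - c < e by lra.
move=> /(_ xce xc0); rewrite /= [_ *: 1]mulr1 subrK distrC ltr_norml => /andP[+ _].
rewrite ltrBrDr addNr /GRing.scale/= pmulr_rgt0 ?subr_gt0//.
by rewrite invr_gt0 subr_gt0.
Qed.

Lemma strict_incr_derive f df a b : a < b ->
  (forall x, a <= x <= b -> is_derive x 1 f (df x)) ->
  (forall x, a < x < b -> 0 < df x) -> f a < f b.
Proof.
move=> ab d d0; rewrite -subr_gt0; have [c [cab ->]] := mean_value ab d.
by rewrite mulr_gt0 ?d0// subr_gt0.
Qed.

Lemma derive_interior_max f df d a b c : a < c < b ->
  (forall x, a <= x <= b -> is_derive x 1 f (df x)) ->
  is_derive c 1 df d -> (forall x, a <= x <= b -> f x <= f c) ->
  df c = 0 /\ d <= 0.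
Proof.
move=> /andP[ac cb] df_ d2 fmax.
have d0 : df c = 0.
  have cd : is_derive c 1 f (df c) by apply: df_; rewrite !ltW.
  have /= [x|||_ E] := @derive1_at_max _ f a b c (ltW (lt_trans ac cb)).
  - by rewrite in_itv/= => /andP[ax xb]; have [] := df_ x; rewrite ?ltW.
  - by rewrite in_itv/= ac.
  - by move=> x; rewrite in_itv/= => /andP[ax xb]; apply: fmax; rewrite !ltW.
  by have [_ <-] := cd.
split=> //; rewrite leNgt; apply/negP => /(derive_gt0_right d2)[e e0 H].
pose z := Num.min b (c + e / 2).
have cz : c < z by rewrite lt_min cb; lra.
have zb : z <= b by rewrite ge_min lexx.
have ze : z <= c + e / 2 by rewrite ge_min lexx orbT.
have : f c < f z.
  apply: (@strict_incr_derive f df) => // [x /andP[cx xz]|x /andP[cx xz]].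
    by apply: df_; apply/andP; split; lra.
  by rewrite -d0; apply: H; apply/andP; split; lra.
by rewrite ltNge fmax//; apply/andP; split; lra.
Qed.

Lemma derive_interior_min f df d a b c : a < c < b ->
  (forall x, a <= x <= b -> is_derive x 1 f (df x)) ->
  is_derive c 1 df d -> (forall x, a <= x <= b -> f c <= f x) ->
  df c = 0 /\ 0 <= d.
Proof.
move=> cab df_ d2 fmin.
have [||H1 H2] := @derive_interior_max (fun x => - f x) (fun x => - df x) (- d) a b c cab.
- by move=> x /df_ ?; exact: dopp.
- by move=> x /fmin; lra.
by split; lra.
Qed.

(* Where W > 0 the function f increases, and where f > 1 the function W does, so
   both conditions persist to the right of a point at which they hold. *)
Lemma growth_persists f df (W dW : R -> R) a b :
  (forall x, a <= x <= b -> is_derive x 1 f (df x) /\ is_derive x 1 W (dW x)) ->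
  (forall x, a <= x <= b -> 0 < W x -> 0 <= df x) ->
  (forall x, a <= x < b -> 1 < f x -> 0 <= dW x) ->
  1 < f a -> 0 < W a -> forall x, a <= x <= b -> W a <= W x /\ f a <= f x.
Proof.
move=> d Wf fW fa Wa.
have fnd c : a <= c <= b -> (forall x, a <= x < c -> W a <= W x) -> f a <= f c.
  move=> /andP[ac cb] Wc; apply: (@ndecr_derive _ f df a c ac) => x /andP[ax xc].
    by have [] := d x _; rewrite ?ax//; lra.
  by apply: Wf; [|apply: lt_le_trans (Wc x _) => //]; apply/andP; split; lra.
pose Bad := [set x | a <= x <= b /\ W x < W a].
suff Bad0 x : a <= x <= b -> W a <= W x.
  move=> x /[dup] axb /andP[ax xb]; split; first exact: Bad0.
  by apply: fnd => // z /andP[az zx]; apply: Bad0; apply/andP; split; lra.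
move=> axb; rewrite leNgt; apply/negP => Wx.
have Bi : has_inf Bad by split; [exists x | exists a => z [/andP[]]].
(* Up to [c] the function W stays above W a, hence so does W c by continuity, and f has not
   decreased. Thus f > 1 slightly beyond [c], where W is then nondecreasing, although bad points
   accumulate there. *)
pose c := inf Bad.
have ac : a <= c by apply: lb_le_inf; [exists x | move=> z [/andP[]]].
have cx : c <= x by apply: ge_inf; [exact: Bi.2 | split].
have cb : c <= b by case/andP: axb => _; exact: le_trans.
have Wc z : a <= z < c -> W a <= W z.
  move=> /andP[az zc]; rewrite leNgt; apply/negP => Wz.
  have : c <= z by apply: ge_inf; [exact: Bi.2 | split=> //; apply/andP; split; lra].
  by lra.
have [fc' Wc'] : is_derive c 1 f (df c) /\ is_derive c 1 W (dW c) by apply: d; rewrite ac.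
have Wac : W a <= W c.
  rewrite leNgt; apply/negP => Wca.
  have [E|ca] := eqVneq c a; first by move: Wca; rewrite E ltxx.
  have [|e e0 H] := @near_gt (fun z => - W z) c (- W a) _ (dopp Wc'); first lra.
  pose z := Num.max a (c - e / 2).
  have az : a <= z by rewrite le_max lexx.
  have zc : z < c by rewrite gt_max lt_neqAle eq_sym ca ac; lra.
  have ze : c - e / 2 <= z by rewrite le_max lexx orbT.
  have := Wc z; rewrite az zc => /(_ isT).
  by have := H z; rewrite ltr_norml => /(_ ltac:(apply/andP; split; lra)); lra.
have fac : f a <= f c by apply: fnd => //; rewrite ac.
have [|e e0 H] := near_gt fc' (m := 1); first lra.
have [z [/andP[az zb] Wz] ze] := inf_adherent e0 Bi; rewrite -/c in ze.
have cz : c <= z by apply: ge_inf; [exact: Bi.2 | split=> //; rewrite az].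
suff : W c <= W z by lra.
apply: (@ndecr_derive _ W dW c z cz) => y /andP[cy yz].
  by have [] := d y _; rewrite ?(le_trans ac cy) ?(le_trans yz zb).
apply: fW; first by apply/andP; split; lra.
by apply: H; rewrite ger0_norm; lra.
Qed.

End RealFunctionsMore.

(** * Uniqueness of the profile *)

Section Uniqueness.
Variable R : realType.
Implicit Types (k h : R -> R) (r x : R).

Definition profile_rhs k (k1 : R -> R) r : R :=
  - 5 * k1 r / r + 21 * k r / r ^+ 2 - k r * (1 - k r ^+ 2).

Definition profile_ode k (k1 : R -> R) := forall r, 0 < r ->
  is_derive r 1 k (k1 r) /\ is_derive r 1 k1 (profile_rhs k k1 r).

(** The information at the singular point r = 0 that makes the weighted Wronskian of two profiles
    tend to 0 there. *)
Definition lipschitz_at0 k (k1 : R -> R) := exists C : R, 0 <= C /\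
  forall r, 0 < r <= 1 -> `|k r| <= C * r /\ `|k1 r| <= C.

Definition tends_to1 k := forall e : R, 0 < e ->
  exists X : R, forall r, X <= r -> `|k r - 1| < e.

Definition wronskian k (k1 : R -> R) h (h1 : R -> R) r : R := r ^+ 5 * (k1 r * h r - h1 r * k r).

Lemma wronskian_derive k (k1 : R -> R) h (h1 : R -> R) r : profile_ode k k1 -> profile_ode h h1 -> 0 < r ->
  is_derive r 1 (wronskian k k1 h h1) (r ^+ 5 * (h r * k r * (k r ^+ 2 - h r ^+ 2))).
Proof.
move=> ok oh r0; have [dk dk1] := ok r r0; have [dh dh1] := oh r r0.
rewrite /wronskian; der.
by rewrite /= /profile_rhs; field; exact: lt0r_neq0.
Qed.

Lemma ratio_derive k (k1 : R -> R) h (h1 : R -> R) r : is_derive r 1 k (k1 r) -> is_derive r 1 h (h1 r) ->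
  h r != 0 -> is_derive r 1 (fun x => k x / h x) ((k1 r * h r - h1 r * k r) / h r ^+ 2).
Proof. by move=> dk dh h0; der; [|rewrite /=; field]. Qed.

Lemma wronskian_at0 k (k1 : R -> R) h (h1 : R -> R) e : lipschitz_at0 k k1 -> lipschitz_at0 h h1 -> 0 < e ->
  exists2 s0, 0 < s0 & forall s, 0 < s <= s0 -> - e <= wronskian k k1 h h1 s.
Proof.
move=> [C [C0 kC]] [D [D0 hD]] e0; pose K := 2 * C * D + 1.
have K0 : 0 < K by have := mulr_ge0 C0 D0; rewrite /K; lra.
exists (Num.min 1 (e / K)); first by rewrite lt_min ltr01 divr_gt0.
move=> s /andP[s0]; rewrite le_min => /andP[s1 sK].
have [kC0 kC1] : `|k s| <= C * s /\ `|k1 s| <= C by apply: kC; rewrite s0.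
have [hD0 hD1] : `|h s| <= D * s /\ `|h1 s| <= D by apply: hD; rewrite s0.
have H1 : `|k1 s * h s| <= C * (D * s) by rewrite normrM; apply: ler_pM.
have H2 : `|h1 s * k s| <= D * (C * s) by rewrite normrM; apply: ler_pM.
have H3 : `|k1 s * h s - h1 s * k s| <= K.
  apply: le_trans (ler_normB _ _) _; apply: le_trans (lerD H1 H2) _.
  have : C * D * s <= C * D by rewrite ler_piMr// mulr_ge0.
  by rewrite /K; lra.
have : `|wronskian k k1 h h1 s| <= s * K.
  rewrite normrM ler_pM//; rewrite normrX gtr0_norm// exprS ger_pMr//.
  by rewrite exprn_ile1// ltW.
have : s * K <= e by rewrite -ler_pdivlMr.
by rewrite ler_norml => ? /andP[? _]; lra.
Qed.

(** The quotient q = k / h increases where the Wronskian W is positive, and W increases where q > 1.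
    Once both hold at some point they persist, so q stays away from 1, against the common limit of k
    and h. *)
Lemma profile_le k (k1 : R -> R) h (h1 : R -> R) : profile_ode k k1 -> profile_ode h h1 ->
  lipschitz_at0 k k1 -> lipschitz_at0 h h1 -> tends_to1 k -> tends_to1 h ->
  (forall r, 0 < r -> 0 < h r) -> forall r, 0 < r -> k r <= h r.
Proof.
move=> ok oh k0 h0 kl hl hp r1 r10; rewrite leNgt; apply/negP => hk.
pose q r := k r / h r; pose dq r := (k1 r * h r - h1 r * k r) / h r ^+ 2.
pose W := wronskian k k1 h h1; pose dW r := r ^+ 5 * (h r * k r * (k r ^+ 2 - h r ^+ 2)).
have dq_ r : 0 < r -> is_derive r 1 q (dq r).
  move=> r0; have [dk _] := ok r r0; have [dh _] := oh r r0.
  by apply: ratio_derive => //; rewrite gt_eqF// hp.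
have dW_ r : 0 < r -> is_derive r 1 W (dW r) by move=> r0; exact: wronskian_derive.
have q1 r : 0 < r -> (1 < q r) = (h r < k r).
  by move=> r0; rewrite /q ltr_pdivlMr ?mul1r// hp.
have dqW r : 0 < r -> (0 < dq r) = (0 < W r).
  move=> r0; rewrite /dq /W /wronskian pmulr_lgt0 ?invr_gt0 ?exprn_gt0 ?hp//.
  by rewrite pmulr_rgt0 ?exprn_gt0.
have dW0 r : 0 < r -> h r < k r -> 0 < dW r.
  move=> r0 hkr; have hr0 := hp r r0.
  rewrite /dW pmulr_rgt0 ?exprn_gt0// pmulr_rgt0 ?mulr_gt0//; last lra.
  by rewrite subr_gt0 ltr_sqr// nnegrE; lra.
(* If k <= h somewhere on ]0, r1], the mean value theorem for q after the last such point gives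
   [r2]. Otherwise W increases on ]0, r1] from the limit 0, and r1 itself will do. *)
have [r2 [r20 [q2 W2]]] : exists r2, 0 < r2 /\ 1 < q r2 /\ 0 < W r2.
  pose A := [set r | 0 < r <= r1 /\ k r <= h r].
  have [[a [/andP[a0 ar1] ka]]|A0] := pselect (A !=set0).
    have As : has_sup A by split; [exists a; rewrite /A/= a0 | exists r1 => z [/andP[]]].
    pose c := sup A.
    have ac : a <= c by apply: sup_upper_bound => //; rewrite /A/= a0.
    have cr1 : c <= r1 by apply: ge_sup; [exact: As.1 | move=> z [/andP[]]].
    have c0 : 0 < c by lra.
    have qc : q c <= 1.
      rewrite leNgt; apply/negP => qc.
      have [e e0 H] := near_gt (dq_ c c0) qc.
      have [z [/andP[z0 zr1] kz] cz] := sup_adherent e0 As.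
      have zc : z <= c by apply: sup_upper_bound => //; rewrite /A/= z0.
      have : 1 < q z by apply: H; rewrite -/c in cz; rewrite ler0_norm; lra.
      by rewrite q1//; lra.
    have clt : c < r1.
      rewrite lt_neqAle cr1 andbT; apply/eqP => E; move: qc; rewrite E leNgt q1//.
      by rewrite hk.
    have [|r2 [/andP[cr2 r2r1] E]] := @mean_value _ q dq c r1 clt.
      by move=> x /andP[cx _]; apply: dq_; lra.
    have r20 : 0 < r2 by lra.
    exists r2; split=> //; split.
      rewrite q1// ltNge; apply/negP => kr2.
      have : r2 <= c by apply: sup_upper_bound => //; rewrite /A/= r20/= ltW.
      by lra.
    rewrite -dqW//; have : 0 < q r1 - q c by have := q1 r1 r10; rewrite hk; lra.
    by rewrite E pmulr_lgt0// subr_gt0.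
  have hk' r : 0 < r <= r1 -> h r < k r.
    by move=> rr; rewrite ltNge; apply/negP => kr; apply: A0; exists r.
  exists r1; split=> //; split; first by rewrite q1.
  have W0 : 0 <= W (r1 / 2).
    apply/ler_addgt0Pr => e e0; have [s0 s00 Hs] := wronskian_at0 k0 h0 e0.
    pose s := Num.min s0 (r1 / 2).
    have ss : s <= r1 / 2 by rewrite ge_min lexx orbT.
    have sp : 0 < s by rewrite lt_min s00 divr_gt0.
    have := Hs s; rewrite sp ge_min lexx => /(_ isT) Ws.
    suff : W s <= W (r1 / 2) by rewrite -/W in Ws; lra.
    apply: (@ndecr_derive _ W dW) => // x /andP[sx xr]; first by apply: dW_; lra.
    by apply/ltW/dW0; [lra|apply: hk'; apply/andP; split; lra].
  apply: le_lt_trans W0 _; apply: (@strict_incr_derive _ W dW); first lra.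
    by move=> x /andP[sx xr]; apply: dW_; lra.
  by move=> x /andP[sx xr]; apply: dW0; [lra|apply: hk'; apply/andP; split; lra].
have qr r : r2 <= r -> q r2 <= q r.
  move=> r2r; have [x|x|x||] := @growth_persists _ q dq W dW r2 r _ _ _ q2 W2 r.
  - by move=> /andP[r2x _]; split; [apply: dq_|apply: dW_]; lra.
  - by move=> /andP[r2x _] Wx; apply: ltW; rewrite dqW//; lra.
  - move=> /andP[r2x _] qx; apply: ltW; apply: dW0; first lra.
    by rewrite -q1//; lra.
  - by rewrite r2r lexx.
  by [].
(* Chosen so that q(r2) (1 - e) exceeds 1 + e, the excess being (q(r2) - 1) / 2. *)
pose e := (q r2 - 1) / (2 * (1 + q r2)).
have e0 : 0 < e by rewrite divr_gt0; lra.
have [X1 kX] := kl e e0; have [X2 hX] := hl e e0.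
pose r := Num.max r2 (Num.max X1 X2).
have rr2 : r2 <= r by rewrite le_max lexx.
have := kX r; rewrite !le_max lexx/= orbT => /(_ isT); rewrite ltr_norml => /andP[_ kr].
have := hX r; rewrite !le_max lexx/= !orbT => /(_ isT); rewrite ltr_norml => /andP[hr _].
have := qr r rr2; rewrite {2}/q ler_pdivlMr ?hp//; last lra.
have : q r2 * (1 - e) <= q r2 * h r by rewrite ler_pM2l; lra.
have : e * (2 * (1 + q r2)) = q r2 - 1 by rewrite /e divfK// mulf_neq0//; lra.
by nra.
Qed.

End Uniqueness.

(** * Positivity of every profile *)

Section Positivity.
Variable R : realType.
Variables k k1 : R -> R.
Hypotheses (ode : profile_ode k k1) (k_at0 : lipschitz_at0 k k1) (k_lim : tends_to1 k).

Let dk (r : R) : 0 < r -> is_derive r 1 k (k1 r).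
Proof. by move=> /ode[]. Qed.

Let dk1 (r : R) : 0 < r -> is_derive r 1 k1 (profile_rhs k k1 r).
Proof. by move=> /ode[]. Qed.

Section LastZero.
Variable r0 : R.
Hypotheses (r0_gt0 : 0 < r0) (k_r0 : k r0 = 0) (k_pos : forall r, r0 < r -> 0 < k r).

(** A decrease would produce an interior maximum at some c and then, since k recovers towards its
    limit 1, an interior minimum at some d > c with k d < k c. The equation gives 21 / c^2 <= 1 -
    k(c)^2 and 1 - k(d)^2 <= 21 / d^2, which are incompatible. *)
Lemma ndecr_after_zero a b : r0 <= a -> a <= b -> k a <= k b.
Proof.
have r0p := r0_gt0; have kr00 := k_r0.
move=> r0a ab; rewrite leNgt; apply/negP => kba.
have r0ltb : r0 < b.
  by rewrite (le_lt_trans r0a)// lt_neqAle ab andbT; apply/eqP => E; move: kba; rewrite E ltxx.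
have kb := k_pos r0ltb.
have kc x y : 0 < x -> {within `[x, y], continuous k}.
  move=> x0; apply: derivable_within_continuous => z; rewrite in_itv/= => /andP[xz _].
  by have [] := dk (lt_le_trans x0 xz).
have [c] := EVT_max (ltW r0ltb) (kc r0 b r0_gt0); rewrite in_itv/= => /andP[r0c cb] cmax.
have kac : k a <= k c by apply: cmax; rewrite in_itv/= r0a.
have {}r0c : r0 < c.
  by rewrite lt_neqAle r0c andbT; apply/eqP => E; move: kac; rewrite -E k_r0; lra.
have {}cb : c < b by rewrite lt_neqAle cb andbT; apply/eqP => E; move: kac; rewrite E; lra.
have c0 : 0 < c := lt_trans r0_gt0 r0c.
have [|x||x|kc1 kc2] := @derive_interior_max _ k k1 (profile_rhs k k1 c) r0 b c.
- by rewrite r0c.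
- by move=> /andP[xr _]; apply: dk; lra.
- exact: dk1.
- by move=> xb; apply: cmax; rewrite in_itv.
have kcp := k_pos r0c.
have kc3 : 21 / c ^+ 2 <= 1 - k c ^+ 2.
  rewrite -(ler_pM2l kcp); move: kc2; rewrite /profile_rhs kc1; lra.
have c21 : 0 < 21 / c ^+ 2 by rewrite divr_gt0// exprn_gt0.
have kc_lt1 : k c < 1 by rewrite ltNge; apply/negP => ?; nra.
have kb1 : 0 < 1 - k b by lra.
have [X HX] := k_lim kb1.
pose Y := Num.max X (b + 1).
have bY : b < Y by rewrite lt_max ltrDl ltr01 orbT.
have kY : k b < k Y.
  by have := HX Y; rewrite le_max lexx => /(_ isT); rewrite ltr_norml => /andP[]; lra.
have cY : c <= Y by lra.
have [d] := EVT_min cY (kc c Y c0); rewrite in_itv/= => /andP[cd dY] dmin.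
have kdb : k d <= k b by apply: dmin; rewrite in_itv/=; apply/andP; split; lra.
have {}cd : c < d by rewrite lt_neqAle cd andbT; apply/eqP => E; move: kdb; rewrite -E; lra.
have {}dY : d < Y by rewrite lt_neqAle dY andbT; apply/eqP => E; move: kdb; rewrite E; lra.
have d0 : 0 < d by lra.
have [|x||x|kd1 kd2] := @derive_interior_min _ k k1 (profile_rhs k k1 d) c Y d.
- by rewrite cd.
- by move=> /andP[xr _]; apply: dk; lra.
- exact: dk1.
- by move=> xb; apply: dmin; rewrite in_itv.
have kdp : 0 < k d by apply: k_pos; lra.
have kd3 : 1 - k d ^+ 2 <= 21 / d ^+ 2.
  rewrite -(ler_pM2l kdp); move: kd2; rewrite /profile_rhs kd1; lra.
have : 21 / d ^+ 2 < 21 / c ^+ 2.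
  by rewrite ltr_pM2l// ltf_pV2 ?posrE ?exprn_gt0// ltr_sqr// nnegrE ltW.
have : k d ^+ 2 < k c ^+ 2 by rewrite ltr_sqr ?nnegrE; lra.
lra.
Qed.

Lemma le1_after_zero r : r0 <= r -> k r <= 1.
Proof.
have r0p := r0_gt0; have kr00 := k_r0.
move=> r0r; rewrite leNgt; apply/negP; rewrite -subr_gt0 => H; have [X HX] := k_lim H.
have := HX (Num.max X r); rewrite le_max lexx => /(_ isT); rewrite ltr_norml => /andP[_].
have : k r <= k (Num.max X r) by apply: ndecr_after_zero => //; rewrite le_max lexx orbT.
lra.
Qed.

Lemma slope_ge0_after_zero r : r0 <= r -> 0 <= k1 r.
Proof.
have r0p := r0_gt0; have kr00 := k_r0.
move=> r0r; rewrite leNgt; apply/negP; rewrite -oppr_gt0 => H.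
have [|e e0 He] := @derive_gt0_right _ (fun x => - k x) r (- k1 r) _ H.
  by apply: dopp; apply: dk; lra.
have := He (r + e / 2); suff : k r <= k (r + e / 2).
  by move=> ? /(_ ltac:(apply/andP; split; lra)); lra.
by apply: ndecr_after_zero => //; lra.
Qed.

(** Stands in for uniqueness of the Cauchy problem. After r0 the friction and the nonlinear term
    have a favourable sign, so k'' <= C k <= mu^2 k and e^(- mu x) (k' + mu k) is nonincreasing. If
    k'(r0) = 0 it starts from 0, yet it is positive at r0 + 1. *)
Lemma slope_gt0_at_zero : 0 < k1 r0.
Proof.
have r0p := r0_gt0; have kr00 := k_r0.
rewrite lt_neqAle slope_ge0_after_zero// andbT eq_sym; apply/eqP => k10.
pose C := 21 / r0 ^+ 2; have C0 : 0 <= C by rewrite divr_ge0// exprn_ge0 ?ltW.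
pose mu := 1 + C; pose E x := - (expR (- mu * x) * (k1 x + mu * k x)).
pose dE x := expR (- mu * x) * (mu ^+ 2 * k x - profile_rhs k k1 x).
have : E r0 <= E (r0 + 1).
  apply: (@ndecr_derive _ E dE) => [|x /andP[r0x _]|x /andP[r0x _]]; first lra.
    have x0 : 0 < x by lra.
    by have := dk x0; have := dk1 x0 => d1 d; rewrite /E /dE; der; rewrite /=; ring.
  rewrite mulr_ge0 ?expR_ge0// subr_ge0 /profile_rhs.
  have x0 : 0 < x by lra.
  have kx := k_pos r0x; have k1x := slope_ge0_after_zero (ltW r0x).
  have kx1 := le1_after_zero (ltW r0x).
  have H1 : 0 <= k1 x / x by rewrite divr_ge0// ltW.
  have H2 : 21 * k x / x ^+ 2 <= C * k x.
    rewrite mulrAC ler_pM2r// /C ler_pM2l// lef_pV2 ?posrE ?exprn_gt0//.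
    by rewrite ler_sqr ?nnegrE; lra.
  have H3 : 0 <= k x * (1 - k x ^+ 2).
    by rewrite mulr_ge0 ?(ltW kx)// subr_ge0 exprn_ile1// ltW.
  have H4 : C * k x <= mu ^+ 2 * k x.
    by rewrite ler_pM2r// /mu; have := sqr_ge0 C; lra.
  lra.
have r01 : r0 < r0 + 1 by lra.
have kp := k_pos r01; have k1p := slope_ge0_after_zero (ltW r01).
have mu0 : 0 < mu by rewrite /mu; lra.
have : 0 < expR (- mu * (r0 + 1)) * (k1 (r0 + 1) + mu * k (r0 + 1)).
  by rewrite mulr_gt0 ?expR_gt0// ltr_wpDl// mulr_gt0.
rewrite /E k10 k_r0; lra.
Qed.

(** Without such a point k would increase strictly on ]0, r0] up to the value 0, and so be bounded
    away from 0 near the origin, where it must tend to 0. [rm] is the last point before r0 with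
    nonpositive slope. *)
Lemma critical_before_zero : exists rm, [/\ 0 < rm < r0, k1 rm <= 0,
  forall r, rm < r <= r0 -> 0 < k1 r & forall r, rm <= r < r0 -> k r < 0].
Proof.
have r0p := r0_gt0; have kr00 := k_r0.
have k1r0 := slope_gt0_at_zero.
pose Z := [set r | 0 < r <= r0 /\ k1 r <= 0].
have Zne : Z !=set0.
  apply: contrapT => Z0; have k1p r : 0 < r <= r0 -> 0 < k1 r.
    by move=> rr; rewrite ltNge; apply/negP => ?; apply: Z0; exists r.
  have incr a b : 0 < a -> a < b -> b <= r0 -> k a < k b.
    move=> a0 ab br0; apply: (@strict_incr_derive _ k k1) => // x /andP[ax xb].
      by apply: dk; lra.
    by apply: k1p; apply/andP; split; lra.
  have kh : k (r0 / 2) < 0 by rewrite -k_r0; apply: incr; lra.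
  have [C [C0 HC]] := k_at0.
  (* Small enough that C s < - k(r0 / 2), hence k s > k(r0 / 2) although s < r0 / 2. *)
  pose s := Num.min (Num.min 1 (r0 / 3)) (- k (r0 / 2) / (C + 1)).
  have s0 : 0 < s by rewrite !lt_min ltr01 !divr_gt0//; lra.
  have s1 : s <= 1 by rewrite !ge_min lexx.
  have s2 : s <= r0 / 3 by rewrite !ge_min lexx orbT.
  have s3 : s <= - k (r0 / 2) / (C + 1) by rewrite !ge_min lexx orbT.
  have [] := HC s; first by rewrite s0.
  rewrite ler_norml => /andP[ks _] _.
  have := incr s (r0 / 2) s0; move=> /(_ ltac:(lra) ltac:(lra)).
  move: s3; rewrite ler_pdivlMr; lra.
have Zs : has_sup Z by split=> //; exists r0 => z [/andP[]].
pose c := sup Z.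
have c0 : 0 < c.
  have [z [/andP[z0 zr] kz]] := Zne; apply: lt_le_trans (z0) _.
  by apply: sup_upper_bound => //; split=> //; apply/andP.
have cr0 : c <= r0 by apply: ge_sup => // z [/andP[]].
have k1c : k1 c <= 0.
  rewrite leNgt; apply/negP => kc; have [e e0 H] := near_gt (dk1 c0) kc.
  have [z [/andP[z0 zr] kz] cz] := sup_adherent e0 Zs; rewrite -/c in cz.
  have zc : z <= c by apply: sup_upper_bound => //; split=> //; apply/andP.
  have : 0 < k1 z by apply: H; rewrite ler0_norm; lra.
  lra.
have {}cr0 : c < r0.
  by rewrite lt_neqAle cr0 andbT; apply/eqP => E; move: k1c; rewrite E; lra.
have k1p r : c < r <= r0 -> 0 < k1 r.
  move=> /andP[cr rr0]; rewrite ltNge; apply/negP => kr.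
  have : r <= c by apply: sup_upper_bound => //; split=> //; apply/andP; split; lra.
  lra.
exists c; split=> //; first by rewrite c0.
move=> r /andP[cr rr0]; rewrite -k_r0; apply: (@strict_incr_derive _ k k1) => // x /andP[rx xr0].
  by apply: dk; lra.
by apply: k1p; apply/andP; split; lra.
Qed.

(* Sturm comparison of k with its reflection x |-> - k (2 r0 - x) at the zero r0:
   the friction term and the repulsive term 21 k / r^2 both make the reflection
   larger, so it keeps increasing and cannot have the critical point found above. *)
Lemma last_zero_absurd : False.
Proof.
have r0p := r0_gt0; have kr00 := k_r0.
have k1r0 := slope_gt0_at_zero.
have [rm [/andP[rm0 rmr0] k1rm k1p kneg]] := critical_before_zero.
pose b := 2 * r0 - rm; have r0b : r0 < b by rewrite /b; lra.
pose K x := - k (2 * r0 - x); pose K1 x := k1 (2 * r0 - x).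
pose K2 x := - profile_rhs k k1 (2 * r0 - x).
have dK x : r0 <= x <= b -> is_derive x 1 K (K1 x).
  move=> /andP[r0x xb]; have x0 : 0 < 2 * r0 - x by rewrite /b in xb; lra.
  by have := dk x0 => d; rewrite /K; der; rewrite /= /K1; ring.
have dK1 x : r0 <= x <= b -> is_derive x 1 K1 (K2 x).
  move=> /andP[r0x xb]; have x0 : 0 < 2 * r0 - x by rewrite /b in xb; lra.
  by have := dk1 x0 => d; rewrite /K1; der; rewrite /= /K2; ring.
pose q x := K x / k x; pose dq x := (K1 x * k x - k1 x * K x) / k x ^+ 2.
pose W x := K1 x * k x - k1 x * K x; pose dW x := K2 x * k x - profile_rhs k k1 x * K x.
have dq_ x : r0 < x <= b -> is_derive x 1 q (dq x).
  move=> /andP[r0x xb]; apply: ratio_derive; first by apply: dK; rewrite ltW.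
    by apply: dk; lra.
  by rewrite gt_eqF// k_pos.
have dW_ x : r0 <= x <= b -> is_derive x 1 W (dW x).
  move=> xx; have d1 := dK x xx; have d2 := dK1 x xx.
  have x0 : 0 < x by case/andP: xx; lra.
  have d3 := dk x0; have d4 := dk1 x0.
  by rewrite /W; der; rewrite /= /dW; ring.
have Kp x : r0 < x <= b -> 0 < K x.
  move=> /andP[r0x xb]; rewrite /K oppr_gt0; apply: kneg; rewrite /b in xb.
  by apply/andP; split; lra.
have q1 x : r0 < x <= b -> (1 < q x) = (k x < K x).
  by move=> /andP[r0x _]; rewrite /q ltr_pdivlMr ?mul1r// k_pos.
have dqW x : r0 < x <= b -> (0 < dq x) = (0 < W x).
  by move=> /andP[r0x _]; rewrite /dq pmulr_lgt0// invr_gt0 exprn_gt0// k_pos.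
have dW0 x : r0 < x < b -> k x < K x -> 0 < dW x.
  move=> /andP[r0x xb] kK; have kx := k_pos r0x.
  have xx : r0 < x <= b by rewrite r0x ltW.
  pose s := 2 * r0 - x; have s0 : 0 < s by rewrite /s /b in xb *; lra.
  have x0 : 0 < x by lra.
  have K1x : 0 < K1 x by apply: k1p; rewrite /b in xb; apply/andP; split; lra.
  have k1x := slope_ge0_after_zero (ltW r0x).
  have -> : dW x = 5 * K1 x * k x / s + 5 * k1 x * K x / x +
      21 * (k x * K x * ((s ^+ 2)^-1 - (x ^+ 2)^-1)) + k x * K x * (K x ^+ 2 - k x ^+ 2).
    rewrite /dW /K2 /profile_rhs /K1 /K -/s.
    by field; rewrite !lt0r_neq0.
  have Kx := Kp x xx.
  have A1 : 0 <= 5 * K1 x * k x / s by rewrite !mulr_ge0 ?invr_ge0// ltW.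
  have A2 : 0 <= 5 * k1 x * K x / x by rewrite !mulr_ge0 ?invr_ge0// ltW.
  have A3 : 0 <= k x * K x * ((s ^+ 2)^-1 - (x ^+ 2)^-1).
    apply: mulr_ge0; first by rewrite mulr_ge0// ltW.
    rewrite subr_ge0 lef_pV2 ?posrE ?exprn_gt0//.
    by rewrite ler_sqr ?nnegrE; rewrite /s in s0 *; lra.
  have A4 : 0 < k x * K x * (K x ^+ 2 - k x ^+ 2).
    by rewrite mulr_gt0 ?mulr_gt0// subr_gt0 ltr_sqr ?nnegrE//; exact: ltW.
  lra.
(* At r0 the two functions have the same value and slope; their second derivatives differ only by
   the friction term, whose sign the reflection reverses, and the gap is 10 k'(r0) / r0 > 0. *)
have [e e0 He] : exists2 e, 0 < e & forall x, r0 < x < r0 + e -> 0 < K1 x - k1 x.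
  have dD : is_derive r0 1 (fun x => K1 x - k1 x) (K2 r0 - profile_rhs k k1 r0).
    have d2 := dK1 r0; have := d2 ltac:(rewrite lexx ltW//) => {}d2.
    by have d4 := dk1 r0_gt0; der.
  have [|e e0 He] := derive_gt0_right dD.
    rewrite /K2 (_ : 2 * r0 - r0 = r0); last by ring.
    rewrite /profile_rhs k_r0 -subr_gt0 subr0.
    have -> : - (-5 * k1 r0 / r0 + 21 * 0 / r0 ^+ 2 - 0 * (1 - 0 ^+ 2)) -
      (-5 * k1 r0 / r0 + 21 * 0 / r0 ^+ 2 - 0 * (1 - 0 ^+ 2)) = 10 * (k1 r0 / r0).
      by field; rewrite lt0r_neq0.
    by rewrite mulr_gt0 ?divr_gt0.
  exists e => // x /He; rewrite /K1 (_ : 2 * r0 - r0 = r0) ?subrr//; ring.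
pose a := Num.min ((r0 + b) / 2) (r0 + e / 2).
have r0a : r0 < a by rewrite lt_min; apply/andP; split; lra.
have ab : a < b by rewrite gt_min; apply/orP; left; lra.
have ae : a <= r0 + e / 2 by rewrite ge_min lexx orbT.
have kK x : r0 < x <= a -> k x < K x.
  move=> /andP[r0x xa]; rewrite -subr_gt0.
  have E0 : K r0 - k r0 = 0.
    by rewrite /K (_ : 2 * r0 - r0 = r0) ?k_r0 ?oppr0 ?subrr//; ring.
  rewrite -[X in X < _]E0.
  apply: (@strict_incr_derive _ (fun z => K z - k z) (fun z => K1 z - k1 z)) => // z /andP[rz zx].
    have d1 := dK z ltac:(apply/andP; split; lra).
    have d2 := dk (lt_le_trans r0_gt0 rz).
    by der.
  by apply: He; apply/andP; split; lra.
have Wr0 : W r0 = 0.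
  by rewrite /W /K (_ : 2 * r0 - r0 = r0) ?k_r0 ?oppr0 ?mulr0 ?subrr//; ring.
have Wa : 0 < W a.
  rewrite -[X in X < _]Wr0; apply: (@strict_incr_derive _ W dW) => // x /andP[rx xa].
    by apply: dW_; apply/andP; split; lra.
  by apply: dW0; [|apply: kK]; apply/andP; split; lra.
have qa : 1 < q a by rewrite q1 ?kK ?lexx ?r0a ?ltW.
have qa' x : a <= x -> r0 < x by move=> ax; lra.
have : W a <= W b /\ q a <= q b.
  apply: (@growth_persists _ q dq W dW a b) => // [x /andP[ax xb]|x /andP[ax xb]|x /andP[ax xb]|].
  - by split; [apply: dq_|apply: dW_]; apply/andP; split; lra.
  - move=> Wx; apply: ltW; rewrite dqW//; apply/andP; split; lra.
  - rewrite q1 => [kx|]; last by apply/andP; split; lra.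
    by apply: ltW; apply: dW0 => //; apply/andP; split; lra.
  - by rewrite ltW//= lexx.
(* At the reflected critical point both terms of W are nonpositive, whereas W has not decreased from
   its positive value at [a]. *)
have -> : W b = k1 rm * k b + k1 b * k rm.
  by rewrite /W /K1 /K /b (_ : 2 * r0 - (2 * r0 - rm) = rm); ring.
have kb := k_pos r0b; have k1b := slope_ge0_after_zero (ltW r0b).
have krm : k rm < 0 by apply: kneg; rewrite lexx.
have B1 : k1 rm * k b <= 0 by rewrite mulr_le0_ge0// ltW.
have B2 : k1 b * k rm <= 0 by rewrite mulr_ge0_le0// ltW.
by case; lra.
Qed.

End LastZero.

(** If k were nonpositive somewhere, the supremum of all such points, finite because k tends to 1,
    would be a last zero. *)
Lemma profile_gt0 r : 0 < r -> 0 < k r.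
Proof.
move=> r_gt0; rewrite ltNge; apply/negP => kr.
pose Z := [set x | 0 < x /\ k x <= 0].
have [X HX] := k_lim (ltr01).
have Zub : ubound Z X.
  move=> x [x0 kx]; rewrite leNgt; apply/negP => /ltW/HX; rewrite ltr_norml => /andP[]; lra.
have Zs : has_sup Z by split; [exists r | exists X].
pose c := sup Z.
have rc : r <= c by apply: sup_upper_bound => //.
have c0 : 0 < c := lt_le_trans r_gt0 rc.
have kp x : c < x -> 0 < k x.
  move=> cx; rewrite ltNge; apply/negP => kx.
  have : x <= c by apply: sup_upper_bound => //; split=> //; lra.
  lra.
have kc : k c = 0.
  apply/le_anti/andP; split; rewrite leNgt; apply/negP => kc.
    have [e e0 H] := near_gt (dk c0) kc.
    have [z [z0 kz] cz] := sup_adherent e0 Zs; rewrite -/c in cz.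
    have zc : z <= c by apply: sup_upper_bound => //; split.
    have : 0 < k z by apply: H; rewrite ler0_norm; lra.
    lra.
  have [|e e0 H] := @near_gt _ (fun x => - k x) c 0 _ (dopp (dk c0)); first lra.
  have : 0 < - k (c + e / 2) by apply: H; rewrite addrAC subrr add0r gtr0_norm; lra.
  have : 0 < k (c + e / 2) by apply: kp; lra.
  lra.
exact: (last_zero_absurd c0 kc kp).
Qed.

End Positivity.

Lemma profile_unique (R : realType) (k k1 h h1 : R -> R) :
  profile_ode k k1 -> profile_ode h h1 -> lipschitz_at0 k k1 -> lipschitz_at0 h h1 ->
  tends_to1 k -> tends_to1 h -> forall r, 0 < r -> k r = h r.
Proof.
move=> ok oh k0 h0 kl hl r r0; apply/le_anti/andP; split.
  by apply: (profile_le ok oh) => //; exact: profile_gt0 oh h0 hl.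
by apply: (profile_le oh ok) => //; exact: profile_gt0 ok k0 kl.
Qed.

(** * From the radial factor to the profile *)

Section HalfLine.
Variable R : realType.
Implicit Types (f h k : R -> R) (r s l e : R).

Lemma is_deriveP f r l : is_derive r 1 f l <->
  forall e, 0 < e -> exists2 d, 0 < d &
    forall s, s != r -> `|s - r| < d -> `|l - (f s - f r) / (s - r)| < e.
Proof.
split=> [[fd <-] e e0|H].
  have /cvgrPdist_lt/(_ e e0)/(@nbhs_ballP R)[d /= d0 Hd] := fd.
  exists d => // s sr srd; have := Hd (s - r); rewrite /ball/= sub0r normrN => /(_ srd).
  rewrite subr_eq0 => /(_ sr); rewrite [_ *: 1]mulr1 subrK /GRing.scale/= mulrC.
  exact.
have C : h^-1 *: ((f \o shift r) (h *: (1 : R)) - f r) @[h --> 0^'] --> l.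
  apply/cvgrPdist_lt => e /H[d d0 Hd]; apply/(@nbhs_ballP R); exists d => //= h.
  rewrite /ball/= sub0r normrN => hd h0; rewrite [_ *: 1]mulr1 /GRing.scale/= mulrC.
  have := Hd (h + r); rewrite addrK; apply => //.
  by rewrite -subr_eq0 addrK.
by split; [apply/cvg_ex; exists l | exact/cvg_lim].
Qed.

Lemma half_line_derivativeP h (h1 : R -> R) : half_line_derivative h h1 <->
  forall r, 0 <= r -> forall e, 0 < e -> exists2 d, 0 < d &
    forall s, 0 <= s -> s != r -> `|s - r| < d -> `|h1 r - (h s - h r) / (s - r)| < e.
Proof.
split=> H r r0.
  move=> e e0; have /cvgrPdist_lt/(_ e e0)/(@nbhs_ballP R)[d /= d0 Hd] := H r r0.
  exists d => // s s0 sr srd; apply: (Hd s) => //.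
  by rewrite /ball/= distrC.
apply/cvgrPdist_lt => e /(H r r0)[d d0 Hd]; apply/(@nbhs_ballP R); exists d => //= s.
by rewrite /ball/= distrC => srd sr s0; exact: Hd.
Qed.

Lemma half_line_continuousP h : {within @half_line R, continuous h} <->
  forall r, 0 <= r -> forall e, 0 < e -> exists2 d, 0 < d &
    forall s, 0 <= s -> `|s - r| < d -> `|h r - h s| < e.
Proof.
split=> [/subspace_continuousP H r r0 e e0|H].
  have /cvgrPdist_lt/(_ e e0)/(@nbhs_ballP R)[d /= d0 Hd] := H r r0.
  exists d => // s s0 srd; apply: (Hd s) => //.
  by rewrite /ball/= distrC.
apply/subspace_continuousP => r r0; apply/cvgrPdist_lt => e /(H r r0)[d d0 Hd].
apply/(@nbhs_ballP R); exists d => //= s.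
by rewrite /ball/= distrC => srd s0; exact: Hd.
Qed.

Lemma half_line_is_derive h (h1 : R -> R) r : half_line_derivative h h1 -> 0 < r ->
  is_derive r 1 h (h1 r).
Proof.
move=> /half_line_derivativeP H r0; apply/is_deriveP => e e0.
have [d d0 Hd] := H r (ltW r0) e e0; exists (Num.min d r); first by rewrite lt_min d0.
move=> s sr; rewrite lt_min => /andP[srd srr]; apply: Hd => //.
by move: srr; rewrite ltr_norml => /andP[]; lra.
Qed.

Lemma tends_to1P h : h r @[r --> +oo] --> (1 : R) <-> tends_to1 h.
Proof.
split=> [H e e0|H].
  have /cvgrPdist_lt/(_ e e0)[M [_ HM]] := H.
  by exists (M + 1) => r Mr; rewrite distrC; apply: HM; lra.
apply/cvgrPdist_lt => e /H[X HX]; exists X; split; first exact: num_real.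
by move=> r /ltW/HX; rewrite distrC.
Qed.

(** The Lipschitz constant at 0 is the maximum of |k'| over [0, 1]; it bounds k as well by the mean
    value theorem, since k(0) = 0. *)
Lemma radial_profile_ode k : radial_profile k -> exists k1 : R -> R,
  [/\ profile_ode k k1, lipschitz_at0 k k1 & tends_to1 k].
Proof.
move=> [[kc [k1 [kd [k1c [k2 [k1d _]]]]]] ode k00 /tends_to1P kl].
exists k1; split=> //.
  move=> r r0; have dk := half_line_is_derive kd r0; have dk1 := half_line_is_derive k1d r0.
  split=> //; have E1 : derive1 k r = k1 r by rewrite derive1E; case: dk.
  have E2 : derive1n 2 k r = k2 r.
    rewrite derive1nS derive1n1 derive1E; case: dk1 => _ <-; apply: near_eq_derive.
    near=> s; have s0 : 0 < s by near: s; exact: lt_nbhsr.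
    by rewrite derive1E; have [_ ->] := half_line_is_derive kd s0.
  suff <- : k2 r = profile_rhs k k1 r by [].
  by have := ode r r0; rewrite E1 E2 /profile_rhs; lra.
have k1c' : {within `[0, 1], continuous k1}.
  by apply: continuous_subspaceW k1c => r /=; rewrite in_itv/= => /andP[].
have [a _ Ha] := EVT_max ler01 k1c'; have [b _ Hb] := EVT_min ler01 k1c'.
pose C := Num.max (k1 a) (- k1 b).
have k1C r : 0 <= r <= 1 -> `|k1 r| <= C.
  move=> r01; rewrite ler_norml /C lerNl !le_max lerN2; apply/andP; split; apply/orP.
    by right; apply: Hb; rewrite in_itv.
  by left; apply: Ha; rewrite in_itv.
exists C; split.
  by apply: le_trans (k1C 0 _); rewrite ?lexx ?ler01.
move=> r /andP[r0 r1]; split; last by apply: k1C; rewrite ltW.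
have [||c] := @MVT_segment _ k k1 0 r (ltW r0).
- by move=> x; rewrite in_itv/= => /andP[x0 _]; exact: half_line_is_derive.
- by apply: continuous_subspaceW kc => z /=; rewrite in_itv/= => /andP[].
rewrite in_itv/= => /andP[c0 cr]; rewrite k00 !subr0 => ->.
by rewrite normrM (gtr0_norm r0) ler_pM2r// k1C// c0; lra.
Unshelve. all: by end_near. Qed.

Variables (G G1 : R -> R).
Hypothesis factor : radial_factor G G1.

Definition profile_of r : R := r ^+ 3 * G (r ^+ 2).
Definition profile_of1 r : R := 3 * r ^+ 2 * G (r ^+ 2) + 2 * r ^+ 4 * G1 (r ^+ 2).
(** The second derivative after G'' has been eliminated by the equation, so that near 0 it is
    controlled by the bounds on G and G'. *)
Definition profile_of2 r : R := 6 * r * G (r ^+ 2) - 10 * r ^+ 3 * G1 (r ^+ 2)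
  - r ^+ 3 * G (r ^+ 2) * (1 - r ^+ 6 * G (r ^+ 2) ^+ 2).

Lemma profile_of_derive r : 0 < r -> is_derive r 1 profile_of (profile_of1 r).
Proof.
move=> r0; have r20 : 0 < r ^+ 2 by rewrite exprn_gt0.
have [dG dG1 _ _ _] := factor r20; rewrite /profile_of; der.
by rewrite /= /profile_of1; ring.
Qed.

Lemma profile_of1_derive r : 0 < r -> is_derive r 1 profile_of1 (profile_of2 r).
Proof.
move=> r0; have r20 : 0 < r ^+ 2 by rewrite exprn_gt0.
have [dG dG1 _ _ _] := factor r20; rewrite /profile_of1; der.
by rewrite /= /profile_of2; field; exact: lt0r_neq0.
Qed.

Lemma profile_of2_derive r : 0 < r -> exists d, is_derive r 1 profile_of2 d.
Proof.
move=> r0; have r20 : 0 < r ^+ 2 by rewrite exprn_gt0.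
have [dG dG1 _ _ _] := factor r20; eexists; rewrite /profile_of2; repeat der_step.
Qed.

Lemma profile_of_ode : profile_ode profile_of profile_of1.
Proof.
move=> r r0; split; first exact: profile_of_derive.
suff <- : profile_of2 r = profile_rhs profile_of profile_of1 r.
  exact: profile_of1_derive.
rewrite /profile_of2 /profile_rhs /profile_of1 /profile_of.
by field; exact: lt0r_neq0.
Qed.

Lemma profile_of_bounds r : 0 < r <= 1 ->
  [/\ `|profile_of r| <= r ^+ 2, `|profile_of1 r| <= 7 * r ^+ 2 & `|profile_of2 r| <= 27 * r].
Proof.
move=> /andP[r0 r1]; have r20 : 0 < r ^+ 2 by rewrite exprn_gt0.
have [_ _ /andP[G0 G1_] /andP[_ F1] G12] := factor r20.
have p2 : r ^+ 2 <= r by rewrite expr2 ger_pMr.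
have p3 : r ^+ 3 <= r ^+ 2 by rewrite exprS ger_pMl.
have p4 : r ^+ 4 <= r ^+ 2 by rewrite (exprD _ 2 2) ger_pMr// (le_trans p2).
have q3 : 0 < r ^+ 3 by rewrite exprn_gt0.
have q4 : 0 < r ^+ 4 by rewrite exprn_gt0.
have E6 : r ^+ 6 = (r ^+ 2) ^+ 3 by rewrite -exprM.
have A1 : r ^+ 2 * G (r ^+ 2) <= r ^+ 2 by rewrite ger_pMr.
have A2 : r ^+ 3 * G (r ^+ 2) <= r ^+ 3 by rewrite ger_pMr.
have A3 : `|r ^+ 4 * G1 (r ^+ 2)| <= r ^+ 4 * 2 by rewrite normrM gtr0_norm// ler_pM2l.
have A4 : `|r ^+ 3 * G1 (r ^+ 2)| <= r ^+ 3 * 2 by rewrite normrM gtr0_norm// ler_pM2l.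
have A5 : r * G (r ^+ 2) <= r by rewrite ger_pMr.
have B1 : 0 < r * G (r ^+ 2) by rewrite mulr_gt0.
have B2 : 0 < r ^+ 2 * G (r ^+ 2) by rewrite mulr_gt0.
have B3 : 0 < r ^+ 3 * G (r ^+ 2) by rewrite mulr_gt0.
have A6 : r ^+ 3 * G (r ^+ 2) * (1 - r ^+ 6 * G (r ^+ 2) ^+ 2) <= r ^+ 3 * G (r ^+ 2).
  by rewrite ger_pMr// gerBl mulr_ge0 ?exprn_ge0 ?ltW.
have B6 : 0 <= r ^+ 3 * G (r ^+ 2) * (1 - r ^+ 6 * G (r ^+ 2) ^+ 2).
  by rewrite mulr_ge0 ?(ltW B3)// subr_ge0 E6.
move: A3 A4; rewrite !ler_norml => /andP[A3 A3'] /andP[A4 A4'].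
rewrite /profile_of /profile_of1 /profile_of2.
by split; apply/andP; split; lra.
Qed.

Lemma profile_of_lipschitz : lipschitz_at0 profile_of profile_of1.
Proof.
exists 7; split=> // r /[dup] rr /andP[r0 r1]; have [H0 H1 _] := profile_of_bounds rr.
have p2 : r ^+ 2 <= r by rewrite expr2 ger_pMr.
by split; lra.
Qed.

Lemma profile_of_gt0 r : 0 < r -> 0 < profile_of r.
Proof.
move=> r0; have r20 : 0 < r ^+ 2 by rewrite exprn_gt0.
by have [_ _ /andP[G0 _] _ _] := factor r20; rewrite mulr_gt0// exprn_gt0.
Qed.

Lemma profile_of_tends_to1 : tends_to1 profile_of.
Proof.
move=> e e0; exists (Num.max 1 (109 / e)) => r; rewrite ge_max => /andP[r1 re].
have r0 : 0 < r by lra.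
have r20 : 0 < r ^+ 2 by rewrite exprn_gt0.
have [_ _ _ /andP[F0 F1] _] := factor r20.
have h0 := profile_of_gt0 r0.
have E : (r ^+ 2) ^+ 3 * G (r ^+ 2) ^+ 2 = profile_of r ^+ 2 by rewrite /profile_of; ring.
rewrite E in F0 F1; set h := profile_of r in h0 F0 F1 *.
have h1 : h <= 1 by rewrite -(@ler_sqr _ h 1) ?nnegrE ?expr1n// ltW.
pose b := 36 / (r ^+ 2 + 36).
have b0 : 0 < b by rewrite divr_gt0//; lra.
have b1 : b <= 1 by rewrite ler_pdivrMr; lra.
have a_b : r ^+ 2 / (r ^+ 2 + 36) = 1 - b by rewrite /b; field; lra.
have be : b < e / 3.
  rewrite /b ltr_pdivrMr; last lra.
  have : 109 <= r * e by rewrite -ler_pdivrMr.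
  have : r * e <= r ^+ 2 * e by rewrite ler_pM2r// expr2 ler_peMr// ltW.
  by lra.
have : 1 - 3 * b <= (1 - b) ^+ 3.
  rewrite -subr_ge0 (_ : _ - _ = b ^+ 2 * (3 - b)); last by ring.
  by rewrite mulr_ge0 ?sqr_ge0//; lra.
rewrite a_b in F0; have : h ^+ 2 <= h by rewrite expr2 ger_pMr.
by rewrite ltr_norml; move=> *; apply/andP; split; lra.
Qed.

Lemma half_line_derivative_of h (h1 : R -> R) C : h 0 = 0 -> h1 0 = 0 ->
  (forall r, 0 < r -> is_derive r 1 h (h1 r)) ->
  (forall r, 0 < r <= 1 -> `|h r| <= C * r ^+ 2) -> half_line_derivative h h1.
Proof.
move=> h00 h10 dh hC; apply/half_line_derivativeP => r; rewrite le_eqVlt => /predU1P[<-|r0] e e0.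
  exists (Num.min 1 (e / (`|C| + 1))); first by rewrite lt_min ltr01 divr_gt0// ltr_wpDl.
  move=> s s0 sn0; rewrite subr0 (ger0_norm s0) lt_min => /andP[s1 sC].
  rewrite h00 h10 subr0 sub0r normrN normrM normfV (ger0_norm s0).
  have sp : 0 < s by rewrite lt_neqAle eq_sym sn0.
  rewrite ltr_pdivrMr//; apply: le_lt_trans (hC s _) _; first by rewrite sp ltW.
  rewrite expr2 mulrA ltr_pM2r//; move: sC; rewrite ltr_pdivlMr ?ltr_wpDl//.
  apply: le_lt_trans; rewrite mulrC ler_pM2l//.
  by have := ler_norm C; lra.
have [d d0 Hd] := (is_deriveP h r (h1 r)).1 (dh r r0) e e0.
by exists d => // s _; exact: Hd.
Qed.

Lemma half_line_continuous_of h C : h 0 = 0 ->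
  (forall r, 0 < r -> exists d, is_derive r 1 h d) ->
  (forall r, 0 < r <= 1 -> `|h r| <= C * r) -> {within @half_line R, continuous h}.
Proof.
move=> h00 dh hC; apply/half_line_continuousP => r; rewrite le_eqVlt => /predU1P[<-|r0] e e0.
  exists (Num.min 1 (e / (`|C| + 1))); first by rewrite lt_min ltr01 divr_gt0// ltr_wpDl.
  move=> s; rewrite subr0 le_eqVlt => /predU1P[<-|s0]; first by rewrite subrr normr0.
  rewrite (gtr0_norm s0) lt_min => /andP[s1 sC].
  rewrite h00 sub0r normrN; apply: le_lt_trans (hC s _) _; first by rewrite s0 ltW.
  move: sC; rewrite ltr_pdivlMr ?ltr_wpDl//.
  apply: le_lt_trans; rewrite mulrC ler_pM2l//.
  by have := ler_norm C; lra.
have [d /is_derive_continuous/cvgrPdist_lt/(_ e e0)/(@nbhs_ballP R)[x /= x0 Hx]] := dh r r0.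
by exists x => // s _ sr; apply: Hx; rewrite /ball/= distrC.
Qed.

Lemma profile_of_radial : radial_profile profile_of.
Proof.
have p2 r : 0 < r <= 1 -> r ^+ 2 <= r by move=> /andP[r0 r1]; rewrite expr2 ger_pMr.
split.
- split.
    apply: (half_line_continuous_of (C := 1)); first by rewrite /profile_of expr0n mul0r.
      by move=> r r0; exists (profile_of1 r); exact: profile_of_derive.
    by move=> r rr; have [+ _ _] := profile_of_bounds rr; have := p2 r rr; lra.
  exists profile_of1; split.
    apply: (half_line_derivative_of (C := 1)).
    + by rewrite /profile_of expr0n mul0r.
    + by rewrite /profile_of1 !expr0n !mulr0 !mul0r addr0.
    + exact: profile_of_derive.
    + by move=> r rr; have [+ _ _] := profile_of_bounds rr; lra.
  split.
    apply: (half_line_continuous_of (C := 7)).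
    + by rewrite /profile_of1 !expr0n !mulr0 !mul0r addr0.
    + by move=> r r0; exists (profile_of2 r); exact: profile_of1_derive.
    + by move=> r rr; have [_ + _] := profile_of_bounds rr; have := p2 r rr; lra.
  exists profile_of2; split.
    apply: (half_line_derivative_of (C := 7)).
    + by rewrite /profile_of1 !expr0n !mulr0 !mul0r addr0.
    + by rewrite /profile_of2 !expr0n !mulr0 !mul0r !subr0.
    + exact: profile_of1_derive.
    + by move=> r rr; have [_ + _] := profile_of_bounds rr.
  split=> //; apply: (half_line_continuous_of (C := 27)).
  + by rewrite /profile_of2 !expr0n !mulr0 !mul0r !subr0.
  + exact: profile_of2_derive.
  + by move=> r rr; have [_ _ +] := profile_of_bounds rr.
- move=> r r0; have dk := profile_of_derive r0; have [_ dk1] := profile_of_ode r0.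
  have -> : derive1 profile_of r = profile_of1 r by rewrite derive1E; case: dk.
  have -> : derive1n 2 profile_of r = profile_rhs profile_of profile_of1 r.
    rewrite derive1nS derive1n1 derive1E; case: dk1 => _ <-; apply: near_eq_derive.
    near=> s; have s0 : 0 < s by near: s; exact: lt_nbhsr.
    by rewrite derive1E; have [_ ->] := profile_of_derive s0.
  by rewrite /profile_rhs; lra.
- by rewrite /profile_of expr0n mul0r.
- exact/tends_to1P/profile_of_tends_to1.
Unshelve. all: by end_near. Qed.

Lemma profile_of_unique k : radial_profile k -> forall r, 0 <= r -> k r = profile_of r.
Proof.
move=> kr r; have [k1 [ok k0 kl]] := radial_profile_ode kr.
rewrite le_eqVlt => /predU1P[<-|r0].
  by case: kr => _ _ -> _; rewrite /profile_of expr0n mul0r.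
exact: (profile_unique ok profile_of_ode k0 profile_of_lipschitz kl profile_of_tends_to1).
Qed.

End HalfLine.

(** * The cubic map *)

Section Coordinates.

Definition o0 : 'I_6 := @Ordinal 6 0 isT.
Definition o1 : 'I_6 := @Ordinal 6 1 isT.
Definition o2 : 'I_6 := @Ordinal 6 2 isT.
Definition o3 : 'I_6 := @Ordinal 6 3 isT.
Definition o4 : 'I_6 := @Ordinal 6 4 isT.
Definition o5 : 'I_6 := @Ordinal 6 5 isT.

Lemma sum6 (V : zmodType) (F : 'I_6 -> V) :
  \sum_i F i = F o0 + F o1 + F o2 + F o3 + F o4 + F o5.
Proof.
rewrite !big_ord_recl big_ord0 addr0 !addrA.
by congr (_ + _ + _ + _ + _ + _); congr F; exact: val_inj.
Qed.

Lemma ord6_ind (P : 'I_6 -> Prop) :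
  P o0 -> P o1 -> P o2 -> P o3 -> P o4 -> P o5 -> forall i, P i.
Proof.
move=> P0 P1 P2 P3 P4 P5 [[|[|[|[|[|[|//]]]]]] Hi].
- by rewrite (_ : Ordinal _ = o0)//; exact: val_inj.
- by rewrite (_ : Ordinal _ = o1)//; exact: val_inj.
- by rewrite (_ : Ordinal _ = o2)//; exact: val_inj.
- by rewrite (_ : Ordinal _ = o3)//; exact: val_inj.
- by rewrite (_ : Ordinal _ = o4)//; exact: val_inj.
- by rewrite (_ : Ordinal _ = o5)//; exact: val_inj.
Qed.

Definition swap (i : 'I_6) : 'I_6 := @Ordinal 6 ((i + 3) %% 6) (ltn_pmod (i + 3) (isT : 0 < 6)%N).

Lemma swapE : (swap o0 = o3) * (swap o1 = o4) * (swap o2 = o5) *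
  (swap o3 = o0) * (swap o4 = o1) * (swap o5 = o2).
Proof. by do !split; apply: val_inj. Qed.

Lemma swapK : involutive swap.
Proof. by apply: ord6_ind; rewrite !swapE. Qed.

End Coordinates.

Section CliffordMap.
Variable R : realType.
Notation V := 'rV[R]_6.
Implicit Types (x y v w : V) (i j : 'I_6).

(** The diagonal matrix of these signs and the permutation [swap] are symmetric, square to the
    identity and anticommute: they form the Clifford system behind F, with bilinear forms [qd] and
    [pd]. *)
Definition half_sign (i : 'I_6) : R := if (i < 3)%N then 1 else -1.

Definition qd x y : R := \sum_i half_sign i * (x 0 i * y 0 i).
Definition pd x y : R := \sum_i x 0 i * y 0 (swap i).
Definition nsq x : R := dotp x x.
Definition qf x : R := qd x x.
Definition pf x : R := pd x x.

Definition phi i x : R :=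
  nsq x * x 0 i - 2 * (qf x * (half_sign i * x 0 i) + pf x * x 0 (swap i)).

Definition Phi x : V := \row_i phi i x.

Definition dphi i x v : R :=
  2 * dotp x v * x 0 i + nsq x * v 0 i -
  2 * (2 * qd x v * (half_sign i * x 0 i) + qf x * (half_sign i * v 0 i)
       + 2 * pd x v * x 0 (swap i) + pf x * v 0 (swap i)).

Definition ddphi i x v w : R :=
  2 * dotp w v * x 0 i + 2 * dotp x v * w 0 i + 2 * dotp x w * v 0 i -
  2 * (2 * qd w v * (half_sign i * x 0 i) + 2 * qd x v * (half_sign i * w 0 i)
       + 2 * qd x w * (half_sign i * v 0 i)
       + 2 * pd w v * x 0 (swap i) + 2 * pd x v * w 0 (swap i) + 2 * pd x w * v 0 (swap i)).

Lemma nsqE x : nsq x = x 0 o0 ^+ 2 + x 0 o1 ^+ 2 + x 0 o2 ^+ 2 + x 0 o3 ^+ 2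
  + x 0 o4 ^+ 2 + x 0 o5 ^+ 2.
Proof. by rewrite /nsq /dotp sum6 !expr2. Qed.

Lemma qdE x y : qd x y = x 0 o0 * y 0 o0 + x 0 o1 * y 0 o1 + x 0 o2 * y 0 o2
  - x 0 o3 * y 0 o3 - x 0 o4 * y 0 o4 - x 0 o5 * y 0 o5.
Proof. by rewrite /qd sum6 /half_sign /= !mul1r !mulN1r. Qed.

Lemma pdE x y : pd x y = x 0 o0 * y 0 o3 + x 0 o1 * y 0 o4 + x 0 o2 * y 0 o5
  + x 0 o3 * y 0 o0 + x 0 o4 * y 0 o1 + x 0 o5 * y 0 o2.
Proof. by rewrite /pd sum6 !swapE. Qed.

Lemma dotpE x y : dotp x y = x 0 o0 * y 0 o0 + x 0 o1 * y 0 o1 + x 0 o2 * y 0 o2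
  + x 0 o3 * y 0 o3 + x 0 o4 * y 0 o4 + x 0 o5 * y 0 o5.
Proof. by rewrite /dotp sum6. Qed.

Lemma phiE x :
  let a := x 0 o0 in let b := x 0 o1 in let c := x 0 o2 in
  let d := x 0 o3 in let e := x 0 o4 in let f := x 0 o5 in
  let A := 3 * (d ^+ 2 + e ^+ 2 + f ^+ 2) - (a ^+ 2 + b ^+ 2 + c ^+ 2) in
  let B := 3 * (a ^+ 2 + b ^+ 2 + c ^+ 2) - (d ^+ 2 + e ^+ 2 + f ^+ 2) in
  let p := a * d + b * e + c * f in
  (phi o0 x = A * a - 4 * p * d) * (phi o1 x = A * b - 4 * p * e) *
  (phi o2 x = A * c - 4 * p * f) * (phi o3 x = B * d - 4 * p * a) *
  (phi o4 x = B * e - 4 * p * b) * (phi o5 x = B * f - 4 * p * c).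
Proof.
by rewrite /= /phi /qf /pf nsqE qdE pdE !swapE /half_sign /=; do !split; ring.
Qed.

Lemma nsq_ge0 x : 0 <= nsq x.
Proof. by apply: sumr_ge0 => i _; rewrite -expr2 sqr_ge0. Qed.

Lemma sqr_enorm x : enorm x ^+ 2 = nsq x.
Proof. by rewrite sqr_sqrtr// nsq_ge0. Qed.

Lemma enorm_ge0 x : 0 <= enorm x. Proof. exact: sqrtr_ge0. Qed.

Lemma coord_le_nsq x i : x 0 i ^+ 2 <= nsq x.
Proof.
rewrite /nsq /dotp (bigD1 i)//= -expr2 lerDl sumr_ge0// => j _.
by rewrite -expr2 sqr_ge0.
Qed.

Lemma nsq_eq0 x : (nsq x == 0) = (x == 0).
Proof.
apply/eqP/eqP => [x0|->]; last by rewrite nsqE !mxE expr0n !addr0.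
apply/rowP => i; rewrite mxE; apply/eqP; rewrite -sqrf_eq0 eq_le sqr_ge0 andbT.
by rewrite -x0 coord_le_nsq.
Qed.

Lemma nsq_gt0 x : (0 < nsq x) = (x != 0).
Proof. by rewrite lt_neqAle nsq_ge0 andbT eq_sym nsq_eq0. Qed.

Lemma enorm_gt0 x : (0 < enorm x) = (x != 0).
Proof. by rewrite sqrtr_gt0 nsq_gt0. Qed.

Lemma nsqZ a x : nsq (a *: x) = a ^+ 2 * nsq x.
Proof. by rewrite !nsqE !mxE; ring. Qed.

Lemma phiZ i a x : phi i (a *: x) = a ^+ 3 * phi i x.
Proof. by rewrite /phi nsqZ /qf /pf !qdE !pdE !mxE; ring. Qed.

Lemma PhiZ a x : Phi (a *: x) = a ^+ 3 *: Phi x.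
Proof. by apply/rowP => i; rewrite !mxE phiZ. Qed.

Lemma nsq_Phi x : nsq (Phi x) = nsq x ^+ 3.
Proof. by rewrite nsqE !mxE !phiE nsqE; ring. Qed.

Lemma dphi_self i x : dphi i x x = 3 * phi i x.
Proof. by rewrite /dphi /phi /nsq /qf /pf; ring. Qed.

Lemma dphiZ i a x v : dphi i (a *: x) v = a ^+ 2 * dphi i x v.
Proof. by rewrite /dphi nsqZ /qf /pf !qdE !pdE !dotpE !mxE; ring. Qed.

Lemma nsq_derive x v : is_derive x v nsq (2 * dotp x v).
Proof.
rewrite (_ : nsq = fun y => y 0 o0 ^+ 2 + y 0 o1 ^+ 2 + y 0 o2 ^+ 2 + y 0 o3 ^+ 2
  + y 0 o4 ^+ 2 + y 0 o5 ^+ 2); last by apply/funext => y; rewrite nsqE.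
by der; rewrite dotpE /=; ring.
Qed.

Lemma qf_derive x v : is_derive x v qf (2 * qd x v).
Proof.
rewrite (_ : qf = fun y => y 0 o0 * y 0 o0 + y 0 o1 * y 0 o1 + y 0 o2 * y 0 o2
  - y 0 o3 * y 0 o3 - y 0 o4 * y 0 o4 - y 0 o5 * y 0 o5).
  by der; rewrite qdE /=; ring.
by apply/funext => y; rewrite /qf qdE.
Qed.

Lemma pf_derive x v : is_derive x v pf (2 * pd x v).
Proof.
rewrite (_ : pf = fun y => y 0 o0 * y 0 o3 + y 0 o1 * y 0 o4 + y 0 o2 * y 0 o5
  + y 0 o3 * y 0 o0 + y 0 o4 * y 0 o1 + y 0 o5 * y 0 o2).
  by der; rewrite pdE /=; ring.
by apply/funext => y; rewrite /pf pdE.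
Qed.

Lemma dotp_derive x v w : is_derive x w (fun y => dotp y v) (dotp w v).
Proof.
rewrite (_ : (fun y => _) = fun y : V => y 0 o0 * v 0 o0 + y 0 o1 * v 0 o1
  + y 0 o2 * v 0 o2 + y 0 o3 * v 0 o3 + y 0 o4 * v 0 o4 + y 0 o5 * v 0 o5).
  by der; rewrite dotpE /=; ring.
by apply/funext => y; rewrite dotpE.
Qed.

Lemma qd_derive x v w : is_derive x w (fun y => qd y v) (qd w v).
Proof.
rewrite (_ : (fun y => _) = fun y : V => y 0 o0 * v 0 o0 + y 0 o1 * v 0 o1
  + y 0 o2 * v 0 o2 - y 0 o3 * v 0 o3 - y 0 o4 * v 0 o4 - y 0 o5 * v 0 o5).
  by der; rewrite qdE /=; ring.
by apply/funext => y; rewrite qdE.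
Qed.

Lemma pd_derive x v w : is_derive x w (fun y => pd y v) (pd w v).
Proof.
rewrite (_ : (fun y => _) = fun y : V => y 0 o0 * v 0 o3 + y 0 o1 * v 0 o4
  + y 0 o2 * v 0 o5 + y 0 o3 * v 0 o0 + y 0 o4 * v 0 o1 + y 0 o5 * v 0 o2).
  by der; rewrite pdE /=; ring.
by apply/funext => y; rewrite pdE.
Qed.

Lemma phi_derive i x v : is_derive x v (phi i) (dphi i x v).
Proof.
have d1 := nsq_derive x v; have d2 := qf_derive x v; have d3 := pf_derive x v.
by rewrite /phi; der; rewrite /dphi /=; ring.
Qed.

Lemma dphi_derive i x v w : is_derive x w (fun y => dphi i y v) (ddphi i x v w).
Proof.
have d1 := nsq_derive x w; have d2 := qf_derive x w; have d3 := pf_derive x w.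
have d4 := dotp_derive x v w; have d5 := qd_derive x v w; have d6 := pd_derive x v w.
by rewrite /dphi; der; rewrite /ddphi /=; ring.
Qed.

Notation e_ i := (delta_mx 0 i : V).

Lemma basisE i j : e_ i 0 j = (j == i)%:R. Proof. by rewrite mxE. Qed.

Lemma dotp_basis x i : dotp x (e_ i) = x 0 i.
Proof. by rewrite /dotp (bigD1 i)//= big1 ?addr0 ?basisE ?eqxx ?mulr1// => j /negbTE ji; rewrite basisE ji mulr0. Qed.

Lemma qd_basis x i : qd x (e_ i) = half_sign i * x 0 i.
Proof.
rewrite /qd (bigD1 i)//= big1 ?addr0 ?basisE ?eqxx ?mulr1// => j /negbTE ji.
by rewrite basisE ji !mulr0.
Qed.

Lemma pd_basis x i : pd x (e_ i) = x 0 (swap i).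
Proof.
rewrite /pd (bigD1 (swap i))//= swapK big1 ?addr0 ?basisE ?eqxx ?mulr1// => j /negbTE ji.
by rewrite basisE -(inj_eq (can_inj swapK)) swapK ji mulr0.
Qed.

Lemma sum_coord_dphi i x : \sum_j x 0 j * dphi i x (e_ j) = 3 * phi i x.
Proof.
rewrite -dphi_self; under eq_bigr do rewrite /dphi dotp_basis qd_basis pd_basis !basisE.
rewrite sum6; elim/ord6_ind: i; rewrite /dphi /qf /pf dotpE nsqE !qdE !pdE !swapE /half_sign /=.
all: ring.
Qed.

Lemma sum_ddphi i x : \sum_j ddphi i x (e_ j) (e_ j) = 0.
Proof.
under eq_bigr do rewrite /ddphi !dotp_basis !qd_basis !pd_basis !basisE.
rewrite sum6; elim/ord6_ind: i; rewrite !swapE /half_sign /=.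
all: ring.
Qed.

End CliffordMap.

(** * Radial fields *)

Section RadialField.
Variable R : realType.
Notation V := 'rV[R]_6.
Notation e_ i := (delta_mx 0 i : V).
Implicit Types (x y v w : V) (i j k : 'I_6) (g dg ddg : R -> R).

Lemma is_derive_row (f : V -> V) x v (d : V) :
  (forall i, is_derive x v (fun y => f y 0 i) (d 0 i)) -> is_derive x v f d.
Proof.
move=> H; have df : derivable f x v.
  by apply/derivable_mxP => i j; rewrite (ord1 i); have [] := H j.
split=> //; rewrite derive_mx//; apply/rowP => j; rewrite !mxE.
by have [_ ->] := H j.
Qed.

Lemma is_derive_coord (f : V -> V) x v d i : is_derive x v f d ->
  is_derive x v (fun y => f y 0 i) (d 0 i).
Proof.
move=> [df <-]; have /derivable_mxP/(_ 0 i) dfi := df.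
by split=> //; rewrite derive_mx// mxE.
Qed.

Lemma continuous_row (f : V -> V) x :
  (forall i, continuous_at x (fun y => f y 0 i)) -> continuous_at x f.
Proof.
move=> H; apply: (@cvgrPdist_le _ _ _ (nbhs x) _ f (f x)).2 => e e0.
near=> y; rewrite /Num.Def.normr/= mx_normrE (bigmax_le _ (ltW e0))//= => -[a i] _.
rewrite !mxE/= (ord1 a).
move: i {a}; near: y; apply: filter_forall => i.
exact: ((cvgrPdist_le (F := nbhs x) _ _).1 (H i)).
Unshelve. all: by end_near. Qed.

Lemma ct_coord i x : continuous_at x (fun y : V => y 0 i).
Proof. exact: coord_continuous. Qed.

Lemma ct_nsq x : continuous_at x (@nsq R).
Proof.
rewrite (_ : @nsq R = fun y => y 0 o0 ^+ 2 + y 0 o1 ^+ 2 + y 0 o2 ^+ 2 + y 0 o3 ^+ 2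
  + y 0 o4 ^+ 2 + y 0 o5 ^+ 2); last by apply/funext => y; rewrite nsqE.
by ct; exact: ct_coord.
Qed.

Lemma ct_dotp v x : continuous_at x (fun y : V => dotp y v).
Proof.
rewrite (_ : (fun y => _) = fun y : V => y 0 o0 * v 0 o0 + y 0 o1 * v 0 o1
  + y 0 o2 * v 0 o2 + y 0 o3 * v 0 o3 + y 0 o4 * v 0 o4 + y 0 o5 * v 0 o5).
  by ct; exact: ct_coord.
by apply/funext => y; rewrite dotpE.
Qed.

Lemma ct_qd v x : continuous_at x (fun y : V => qd y v).
Proof.
rewrite (_ : (fun y => _) = fun y : V => y 0 o0 * v 0 o0 + y 0 o1 * v 0 o1
  + y 0 o2 * v 0 o2 - y 0 o3 * v 0 o3 - y 0 o4 * v 0 o4 - y 0 o5 * v 0 o5).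
  by ct; exact: ct_coord.
by apply/funext => y; rewrite qdE.
Qed.

Lemma ct_pd v x : continuous_at x (fun y : V => pd y v).
Proof.
rewrite (_ : (fun y => _) = fun y : V => y 0 o0 * v 0 o3 + y 0 o1 * v 0 o4
  + y 0 o2 * v 0 o5 + y 0 o3 * v 0 o0 + y 0 o4 * v 0 o1 + y 0 o5 * v 0 o2).
  by ct; exact: ct_coord.
by apply/funext => y; rewrite pdE.
Qed.

Lemma ct_qf x : continuous_at x (@qf R).
Proof.
rewrite (_ : @qf R = fun y : V => y 0 o0 * y 0 o0 + y 0 o1 * y 0 o1
  + y 0 o2 * y 0 o2 - y 0 o3 * y 0 o3 - y 0 o4 * y 0 o4 - y 0 o5 * y 0 o5).
  by ct; exact: ct_coord.
by apply/funext => y; rewrite /qf qdE.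
Qed.

Lemma ct_pf x : continuous_at x (@pf R).
Proof.
rewrite (_ : @pf R = fun y : V => y 0 o0 * y 0 o3 + y 0 o1 * y 0 o4
  + y 0 o2 * y 0 o5 + y 0 o3 * y 0 o0 + y 0 o4 * y 0 o1 + y 0 o5 * y 0 o2).
  by ct; exact: ct_coord.
by apply/funext => y; rewrite /pf pdE.
Qed.

Ltac ct_atom :=
  lazymatch goal with |- continuous_at _ ?f =>
    lazymatch f with
    | context [@nsq] => exact: ct_nsq
    | context [@qf] => exact: ct_qf
    | context [@pf] => exact: ct_pf
    | context [@dotp] => exact: ct_dotp
    | context [@qd] => exact: ct_qd
    | context [@pd] => exact: ct_pd
    | _ => exact: ct_coord
    end
  end.

Lemma ct_phi i x : continuous_at x (@phi R i).
Proof.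
rewrite /phi; ct; ct_atom.
Qed.

Lemma ct_dphi i v x : continuous_at x (fun y => dphi i y v).
Proof.
rewrite /dphi; ct; ct_atom.
Qed.

Lemma ct_ddphi i v w x : continuous_at x (fun y => ddphi i y v w).
Proof.
rewrite /ddphi; ct; ct_atom.
Qed.

Ltac ct_field :=
  lazymatch goal with |- continuous_at _ ?f =>
    lazymatch f with
    | context [@ddphi] => exact: ct_ddphi
    | context [@dphi] => exact: ct_dphi
    | context [@phi] => exact: ct_phi
    | _ => exact: ct_dotp
    end
  end.

Definition field g x : V := g (nsq x) *: Phi x.

Definition field1 g dg v x : V :=
  \row_i (dg (nsq x) * (2 * dotp x v) * phi i x + g (nsq x) * dphi i x v).

Definition field2 g dg ddg v w x : V := \row_i
  (ddg (nsq x) * (2 * dotp x w) * (2 * dotp x v) * phi i x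
   + dg (nsq x) * (2 * dotp w v) * phi i x
   + dg (nsq x) * (2 * dotp x v) * dphi i x w
   + dg (nsq x) * (2 * dotp x w) * dphi i x v
   + g (nsq x) * ddphi i x v w).

Lemma fieldE g i : (fun x => field g x 0 i) = fun x => g (nsq x) * phi i x.
Proof. by apply/funext => x; rewrite !mxE. Qed.

Lemma field1E g dg v i : (fun x => field1 g dg v x 0 i) =
  fun x => dg (nsq x) * (2 * dotp x v) * phi i x + g (nsq x) * dphi i x v.
Proof. by apply/funext => x; rewrite !mxE. Qed.

Lemma field2E g dg ddg v w i : (fun x => field2 g dg ddg v w x 0 i) = fun x =>
  ddg (nsq x) * (2 * dotp x w) * (2 * dotp x v) * phi i x
   + dg (nsq x) * (2 * dotp w v) * phi i x
   + dg (nsq x) * (2 * dotp x v) * dphi i x w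
   + dg (nsq x) * (2 * dotp x w) * dphi i x v
   + g (nsq x) * ddphi i x v w.
Proof. by apply/funext => x; rewrite !mxE. Qed.

Lemma field_derive g dg x v : is_derive (nsq x) 1 g (dg (nsq x)) ->
  is_derive x v (field g) (field1 g dg v x).
Proof.
move=> d; apply: is_derive_row => i; rewrite fieldE mxE.
have d1 := nsq_derive x v; have d2 := phi_derive i x v.
by der; rewrite /=; ring.
Qed.

Lemma field1_derive g dg ddg x v w : is_derive (nsq x) 1 g (dg (nsq x)) ->
  is_derive (nsq x) 1 dg (ddg (nsq x)) ->
  is_derive x w (field1 g dg v) (field2 g dg ddg v w x).
Proof.
move=> d d'; apply: is_derive_row => i; rewrite field1E mxE.
have d1 := nsq_derive x w; have d2 := phi_derive i x w; have d3 := dphi_derive i x v w.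
have d4 := dotp_derive x v w.
by der; rewrite /=; ring.
Qed.

Lemma ct_field1 g dg v x : continuous_at (nsq x) g -> continuous_at (nsq x) dg ->
  continuous_at x (field1 g dg v).
Proof.
move=> gc dgc; apply: continuous_row => i; rewrite field1E.
have ctg := ct_comp gc (@ct_nsq x); have ctdg := ct_comp dgc (@ct_nsq x).
by ct; ct_field.
Qed.

Lemma ct_field2 g dg ddg v w x : continuous_at (nsq x) g -> continuous_at (nsq x) dg ->
  continuous_at (nsq x) ddg -> continuous_at x (field2 g dg ddg v w).
Proof.
move=> gc dgc ddgc; apply: continuous_row => i; rewrite field2E.
have ctg := ct_comp gc (@ct_nsq x); have ctdg := ct_comp dgc (@ct_nsq x).
have ctddg := ct_comp ddgc (@ct_nsq x).
by ct; ct_field.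
Qed.

Lemma nsq_field g x : nsq (field g x) = g (nsq x) ^+ 2 * nsq x ^+ 3.
Proof. by rewrite nsqZ nsq_Phi. Qed.

Lemma Phi0 : Phi 0 = 0 :> V.
Proof. by have := PhiZ 0 (0 : V); rewrite scale0r expr0n scale0r. Qed.

Lemma phi0 i : phi i (0 : V) = 0.
Proof. by have := congr1 (fun v : V => v 0 i) Phi0; rewrite !mxE. Qed.

Lemma dphi0 i v : dphi i 0 v = 0 :> R.
Proof. by have := dphiZ i 0 0 v; rewrite scale0r expr0n mul0r. Qed.

Lemma ddphi0 i v w : ddphi i 0 v w = 0 :> R.
Proof. by rewrite /ddphi !dotpE !qdE !pdE !mxE; ring. Qed.

(** Half of the coefficient 24 is 2 * 6, from the dimension; the other half is 4 * 3, from Euler's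
    identity for a cubic. The term in g vanishes because [phi k] is harmonic. *)
Lemma laplacian_field_coord g dg ddg k x :
  \sum_i field2 g dg ddg (e_ i) (e_ i) x 0 k =
  (4 * (nsq x * ddg (nsq x)) + 24 * dg (nsq x)) * phi k x.
Proof.
under eq_bigr do rewrite mxE !dotp_basis basisE eqxx.
have E1 := sum_coord_dphi k x; have E2 := sum_ddphi k x.
transitivity (4 * ddg (nsq x) * phi k x * (\sum_i x 0 i * x 0 i)
  + dg (nsq x) * 2 * phi k x * 6 + 4 * dg (nsq x) * (\sum_j x 0 j * dphi k x (e_ j))
  + g (nsq x) * \sum_j ddphi k x (e_ j) (e_ j)).
  by rewrite !sum6 /=; ring.
by rewrite E1 E2 /nsq /dotp; ring.
Qed.

End RadialField.

(** * Regularity at the origin and the Ginzburg-Landau system *)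

Section GinzburgLandau.
Variable R : realType.
Notation V := 'rV[R]_6.
Notation e_ i := (delta_mx 0 i : V).
Implicit Types (x y v w : V) (i j k : 'I_6).

Lemma is_derive_quadratic (f : R -> R) C : f 0 = 0 ->
  (forall t, 0 < `|t| <= 1 -> `|f t| <= C * t ^+ 2) -> is_derive (0 : R) 1 f 0.
Proof.
move=> f0 fC; apply/is_deriveP => e e0.
exists (Num.min 1 (e / (`|C| + 1))); first by rewrite lt_min ltr01 divr_gt0// ltr_wpDl.
move=> s s0; rewrite f0 !subr0 sub0r normrN lt_min => /andP[s1 sC].
have sp : 0 < `|s| by rewrite normr_gt0.
rewrite normrM normfV ltr_pdivrMr//; apply: le_lt_trans (fC s _) _; first by rewrite sp ltW.
rewrite -(real_normK (num_real s)) expr2 mulrA ltr_pM2r//; move: sC; rewrite ltr_pdivlMr ?ltr_wpDl//.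
apply: le_lt_trans; rewrite mulrC ler_pM2l//.
by have := ler_norm C; lra.
Qed.

(** Serves for expressions containing G and its derivatives near t = 0, where only bounds on them
    are known. *)
Lemma ct_dominated (f b : V -> R) : f 0 = 0 -> b 0 = 0 -> continuous_at (0 : V) b ->
  (forall y, y != 0 -> `|f y| <= b y) -> continuous_at (0 : V) f.
Proof.
move=> f0 b0 bc fb; apply: (@cvgrPdist_lt _ _ _ (nbhs (0 : V)) _ f (f 0)).2 => e e0.
have H := (@cvgrPdist_lt _ _ _ (nbhs (0 : V)) _ b (b 0)).1 bc e e0.
near=> y; have : `|b 0 - b y| < e by near: y; exact: H.
rewrite b0 f0 !sub0r !normrN => bye; have [->|y0] := eqVneq y 0.
  by rewrite f0 normr0.
by apply: le_lt_trans (fb y y0) _; apply: le_lt_trans bye; exact: ler_norm.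
Unshelve. all: by end_near. Qed.

Lemma nsq_basis i : nsq (e_ i) = 1.
Proof. by rewrite /nsq dotp_basis basisE eqxx. Qed.

Lemma coord_mul_le x i j : `|x 0 i * x 0 j| <= nsq x.
Proof.
have := coord_le_nsq x i; have := coord_le_nsq x j; have := sqr_ge0 (x 0 i + x 0 j).
have := sqr_ge0 (x 0 i - x 0 j).
by rewrite ler_norml => *; apply/andP; split; lra.
Qed.

Variables G G1 : R -> R.
Hypothesis factor : radial_factor G G1.

Definition factor2 t : R := (- 6 * G1 t - G t * (1 - t ^+ 3 * G t ^+ 2) / 4) / t.

(** Only t G'' is bounded, by 6 * 2 + 1/4. This suffices because in the second derivatives of the
    field G'' comes with a product x_i x_j, of size at most t. *)
Lemma factor2_bound t : 0 < t -> `|t * factor2 t| <= 13.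
Proof.
move=> t0; have [_ _ /andP[G0 G1_] /andP[_ F1] G12] := factor t0.
have F0 : 0 <= t ^+ 3 * G t ^+ 2 by rewrite mulr_ge0 ?sqr_ge0 ?exprn_ge0 ?ltW.
have H : G t * (1 - t ^+ 3 * G t ^+ 2) <= G t by rewrite ger_pMr//; lra.
have H0 : 0 <= G t * (1 - t ^+ 3 * G t ^+ 2) by rewrite mulr_ge0//; lra.
rewrite /factor2 mulrCA divff ?mulr1 ?lt0r_neq0//.
by move: G12; rewrite !ler_norml => /andP[? ?]; apply/andP; split; lra.
Qed.

(** At the origin [radial_factor] gives no information on G, so the derivative is found from the
    size of the field: along a coordinate axis it is of order |t|^3. *)
Lemma field_derive_factor x i : is_derive x (e_ i) (field G) (field1 G G1 (e_ i) x).
Proof.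
have [->|x0] := eqVneq x 0; last first.
  by have [dG _ _ _ _] := factor (etrans (nsq_gt0 x) x0); exact: field_derive.
apply: is_derive_row => k; rewrite fieldE mxE phi0 dphi0 !mulr0 addr0.
apply/is_derive_line; apply: (@is_derive_quadratic _ `|phi k (e_ i)|).
  by rewrite scale0r addr0 phi0 mulr0.
move=> t /andP[t0 t1]; rewrite addr0 nsqZ nsq_basis mulr1 phiZ normrM normrM.
have t20 : 0 < t ^+ 2 by rewrite exprn_even_gt0//= -normr_gt0.
have [_ _ /andP[G0 G1_] _ _] := factor t20.
rewrite mulrA [leRHS]mulrC; apply: ler_wpM2r => //.
have t3 : `|t ^+ 3| <= t ^+ 2.
  by rewrite normrX exprS (real_normK (num_real t)) ler_piMl// ltW.
by rewrite (gtr0_norm G0); apply: le_trans t3; rewrite ler_piMl.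
Qed.

Lemma field1_derive_factor x i j :
  is_derive x (e_ j) (field1 G G1 (e_ i)) (field2 G G1 factor2 (e_ i) (e_ j) x).
Proof.
have [->|x0] := eqVneq x 0; last first.
  by have [dG dG1 _ _ _] := factor (etrans (nsq_gt0 x) x0); exact: field1_derive.
apply: is_derive_row => k; rewrite field1E mxE phi0 !dphi0 ddphi0 !mulr0 !addr0.
apply/is_derive_line.
apply: (@is_derive_quadratic _ (4 * `|phi k (e_ j)| + `|dphi k (e_ j) (e_ i)|)).
  by rewrite scale0r addr0 phi0 dphi0 !mulr0 addr0.
move=> t /andP[t0 t1]; rewrite addr0 nsqZ nsq_basis mulr1 phiZ dphiZ dotp_basis.
have t20 : 0 < t ^+ 2 by rewrite exprn_even_gt0//= -normr_gt0.
have [_ _ /andP[G0 G1_] _ G12] := factor t20.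
have d1 : `|e_ j 0 i| <= 1 by rewrite basisE; case: eqP => _; rewrite ?normr1 ?normr0.
have te : (t *: e_ j : V) 0 i = t * e_ j 0 i by rewrite mxE.
rewrite te; apply: le_trans (ler_normD _ _) _.
rewrite [leRHS]mulrDl; apply: lerD.
  rewrite (_ : _ * _ = 2 * (G1 (t ^+ 2) * e_ j 0 i) * (t ^+ 2) * (t ^+ 2 * phi k (e_ j))); last by ring.
  have s1 : t ^+ 2 <= 1 by rewrite -(real_normK (num_real t)) exprn_ile1// ltW.
  move: (t ^+ 2) t20 s1 G12 => s s0 s1 G12.
  have A : `|2 * (G1 s * e_ j 0 i)| <= 4.
    rewrite !normrM (ger0_norm (ler0n _ 2)).
    by have := ler_pM (normr_ge0 _) (normr_ge0 _) G12 d1; lra.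
  have B : `|s * phi k (e_ j)| = s * `|phi k (e_ j)| by rewrite normrM gtr0_norm.
  have C : `|2 * (G1 s * e_ j 0 i) * s| <= 4 * 1.
    by rewrite normrM (gtr0_norm s0); apply: ler_pM => //; exact: ltW.
  rewrite normrM B [leRHS](_ : _ = 4 * 1 * (s * `|phi k (e_ j)|)); last by ring.
  by apply: ler_wpM2r => //; rewrite mulr_ge0// ltW.
rewrite normrM (gtr0_norm G0) [`|t ^+ 2 * _|]normrM (gtr0_norm t20) [leRHS]mulrC.
by rewrite ler_piMl// mulr_ge0// ltW.
Qed.

Lemma field2_continuous_factor x i j :
  continuous_at x (field2 G G1 factor2 (e_ i) (e_ j)).
Proof.
have [->|x0] := eqVneq x 0; last first.
  have n0 : 0 < nsq x by rewrite nsq_gt0.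
  have [dG dG1 _ _ _] := factor n0.
  have c := is_derive_continuous dG; have c1 := is_derive_continuous dG1.
  apply: ct_field2 => //; have idc : continuous_at (nsq x) (fun t : R => t) by exact: cvg_id.
  by rewrite /factor2; ct; exact: lt0r_neq0.
apply: continuous_row => k; rewrite field2E.
(* A continuous majorant vanishing at 0: 52 is 4 times the bound 13 on t G'', and each 4 is 2 times
   the bound 2 on G'. *)
pose b y := 52 * `|phi k y| + 4 * `|phi k y| + 4 * `|y 0 i| * `|dphi k y (e_ j)|
  + 4 * `|y 0 j| * `|dphi k y (e_ i)| + `|ddphi k y (e_ i) (e_ j)|.
apply: (@ct_dominated _ b).
- by rewrite phi0 !dphi0 ddphi0 !mulr0 !addr0.
- by rewrite /b phi0 !dphi0 ddphi0 !normr0 !mulr0 !addr0.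
- rewrite /b; ct; lazymatch goal with |- continuous_at _ ?f =>
    lazymatch f with
    | context [@ddphi] => exact: ct_ddphi
    | context [@dphi] => exact: ct_dphi
    | context [@phi] => exact: ct_phi
    | _ => exact: ct_coord
    end
  end.
move=> y y0; have n0 : 0 < nsq y by rewrite nsq_gt0.
have [_ _ /andP[G0 G1_] _ G12] := factor n0.
have H2 := factor2_bound n0.
have d1 : `|e_ j 0 i| <= 1 by rewrite basisE; case: eqP => _; rewrite ?normr1 ?normr0.
rewrite !dotp_basis /b.
apply: le_trans (ler_normD _ _) _; apply: lerD; last first.
  by rewrite normrM (gtr0_norm G0) ler_piMl.
apply: le_trans (ler_normD _ _) _; apply: lerD; last first.
  rewrite normrM; apply: ler_wpM2r => //.
  rewrite mulrCA !normrM (ger0_norm (ler0n _ 2)).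
  have := ler_wpM2r (normr_ge0 (y 0 j)) G12; lra.
apply: le_trans (ler_normD _ _) _; apply: lerD; last first.
  rewrite normrM; apply: ler_wpM2r => //.
  rewrite mulrCA !normrM (ger0_norm (ler0n _ 2)).
  have := ler_wpM2r (normr_ge0 (y 0 i)) G12; lra.
apply: le_trans (ler_normD _ _) _; apply: lerD; last first.
  rewrite normrM; apply: ler_wpM2r => //.
  rewrite (_ : _ * _ = 2 * (G1 (nsq y) * e_ j 0 i)); last by ring.
  rewrite !normrM (ger0_norm (ler0n _ 2)).
  by have := ler_pM (normr_ge0 _) (normr_ge0 _) G12 d1; lra.
rewrite (_ : _ * phi k y = 4 * ((factor2 (nsq y) * (y 0 j * y 0 i)) * phi k y)); last by ring.
rewrite normrM (ger0_norm (ler0n _ 4)) normrM mulrA.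
apply: ler_wpM2r => //; suff : `|factor2 (nsq y) * (y 0 j * y 0 i)| <= 13 by lra.
apply: le_trans H2; rewrite mulrC normrM [leRHS]normrM (gtr0_norm n0).
by apply: ler_wpM2r => //; exact: coord_mul_le.
Qed.

Lemma partial_field i : partial i (field G) = field1 G G1 (e_ i).
Proof. by apply/funext => x; rewrite /partial; have [_ ->] := field_derive_factor x i. Qed.

Lemma partial_field1 i j :
  partial j (field1 G G1 (e_ i)) = field2 G G1 factor2 (e_ i) (e_ j).
Proof. by apply/funext => x; rewrite /partial; have [_ ->] := field1_derive_factor x i j. Qed.

Lemma field_C2 : Ck 2 setT (field G).
Proof.
move=> i; split=> [x _|]; first by have [] := field_derive_factor x i.
rewrite partial_field => j; split=> [x _|]; first by have [] := field1_derive_factor x i j.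
by rewrite partial_field1 => x _; exact: field2_continuous_factor.
Qed.

Lemma field_ginzburg_landau : ginzburg_landau (field G).
Proof.
split; first exact: field_C2; move=> x; rewrite sqr_enorm nsq_field.
apply/rowP => k; rewrite summxE !mxE.
under eq_bigr do rewrite partial_field partial_field1.
rewrite laplacian_field_coord; have [->|x0] := eqVneq x 0.
  by rewrite phi0 !mulr0.
have n0 : 0 < nsq x by rewrite nsq_gt0.
by rewrite /factor2; field; exact: lt0r_neq0.
Qed.

End GinzburgLandau.

(** * Comparison with the isoparametric polynomial *)

Section Isoparametric.
Variable R : realType.
Notation V := 'rV[R]_6.
Notation e_ i := (delta_mx 0 i : V).
Implicit Types (x y v w z : V) (i j k : 'I_6).

Lemma isoparamE z : isoparam z = nsq z ^+ 2 - 2 * (qf z ^+ 2 + pf z ^+ 2).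
Proof.
rewrite /isoparam !sqr_sqrtr; try by apply: sumr_ge0 => i _; rewrite -expr2 sqr_ge0.
rewrite /dotp !big_ord_recl !big_ord0 !addr0 !mxE.
have -> : @lshift 3 3 ord0 = o0 by exact: val_inj.
have -> : @lshift 3 3 (lift ord0 ord0) = o1 by exact: val_inj.
have -> : @lshift 3 3 (lift ord0 (lift ord0 ord0)) = o2 by exact: val_inj.
have -> : @rshift 3 3 ord0 = o3 by exact: val_inj.
have -> : @rshift 3 3 (lift ord0 ord0) = o4 by exact: val_inj.
have -> : @rshift 3 3 (lift ord0 (lift ord0 ord0)) = o5 by exact: val_inj.
by rewrite nsqE /qf /pf qdE pdE; ring.
Qed.

Lemma isoparam_gradient_mapE z : isoparam_gradient_map z = Phi z.
Proof.
apply/rowP => i; rewrite !mxE /partial.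
have d1 := nsq_derive z (e_ i); have d2 := qf_derive z (e_ i); have d3 := pf_derive z (e_ i).
have [_ ->] : is_derive z (e_ i) (@isoparam R) (4 * phi i z).
  rewrite (_ : @isoparam R = fun z => nsq z ^+ 2 - 2 * (qf z ^+ 2 + pf z ^+ 2)).
    by der; rewrite /= dotp_basis qd_basis pd_basis /phi; ring.
  by apply/funext => y; rewrite isoparamE.
by rewrite mulKf.
Qed.

Variables G G1 : R -> R.
Hypothesis factor : radial_factor G G1.

Lemma field_radial x : x != 0 ->
  field G x = profile_of G (enorm x) *: isoparam_gradient_map (normalize x).
Proof.
move=> x0; rewrite isoparam_gradient_mapE /normalize PhiZ scalerA /profile_of sqr_enorm.
have r0 : enorm x != 0 by rewrite lt0r_neq0// enorm_gt0.
by rewrite /field; congr (_ *: _); field.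
Qed.

Lemma enorm_field x : x != 0 -> enorm (field G x) = profile_of G (enorm x).
Proof.
move=> x0; have r0 : 0 < enorm x by rewrite enorm_gt0.
apply/eqP; rewrite -(@eqrXn2 _ 2)//; last 2 first.
- exact: enorm_ge0.
- exact: ltW (profile_of_gt0 factor r0).
by rewrite sqr_enorm nsq_field -!sqr_enorm /profile_of; apply/eqP; ring.
Qed.

Lemma field_norm_tends_to_1 : norm_tends_to_1 (field G).
Proof.
move=> e e0; have [X HX] := profile_of_tends_to1 factor e0.
exists (Num.max X 0); split; first exact: num_real.
move=> r; rewrite gt_max => /andP[Xr r0] x rx.
have x0 : x != 0 by rewrite -enorm_gt0 (lt_le_trans r0).
by rewrite enorm_field//; apply: HX; rewrite ltW// (lt_le_trans Xr).
Qed.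

Lemma field_neq0 x : x != 0 -> field G x != 0.
Proof.
move=> x0; rewrite -enorm_gt0 enorm_field//.
by apply: (profile_of_gt0 factor); rewrite enorm_gt0.
Qed.

(** Along a ray issuing from [x0] the field equals h(t) times a fixed vector, which tends to 0 with
    t because h(0) = 0. Hence the field vanishes at [x0], and its only zero is the origin. *)
Lemma field_standard_center (x0 : V) (A : 'M[R]_6) (h : R -> R) :
  half_line_smooth h -> h 0 = 0 ->
  (forall x, x != x0 -> field G x = h (enorm (x - x0)) *: (normalize (x - x0) *m A)) ->
  x0 = 0.
Proof.
move=> hs h0 E; apply/eqP; apply: contraT => /field_neq0/eqP; case.
apply/rowP => i; rewrite [RHS]mxE; apply/eqP; rewrite -normr_le0.
apply/ler_addgt0Pr => e e0; rewrite add0r.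
have Et t : 0 < t -> field G (t *: e_ o0 + x0) = h t *: (e_ o0 *m A).
  move=> t0; rewrite E; last first.
    rewrite -subr_eq0 addrK -nsq_gt0 nsqZ nsq_basis mulr1 exprn_gt0//.
  rewrite addrK /normalize.
  have -> : enorm (t *: e_ o0) = t.
    apply/eqP; rewrite -(@eqrXn2 _ 2)// ?enorm_ge0 ?ltW//.
    by rewrite sqr_enorm nsqZ nsq_basis mulr1.
  by rewrite scalerA mulVf ?scale1r// lt0r_neq0.
have dc : is_derive (0 : R) 1 (fun t => field G (t *: e_ o0 + x0) 0 i) (field1 G G1 (e_ o0) x0 0 i).
  apply: (is_derive_line (fun y => field G y 0 i) x0 (e_ o0) _).1.
  exact: is_derive_coord (field_derive_factor factor x0 o0).
have /cvgrPdist_le/(_ (e / 2))/= := is_derive_continuous dc; rewrite divr_gt0// => /(_ isT).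
move=> /(@nbhs_ballP R)[d /= d0 Hd].
have /half_line_continuousP/(_ 0 (lexx 0)) : {within @half_line R, continuous h} by case: (hs 0%N).
pose a := (e_ o0 *m A) 0 i.
have K0 : 0 < `|a| + 1 by rewrite ltr_wpDl.
move=> /(_ (e / 2 / (`|a| + 1))); rewrite !divr_gt0// => /(_ isT)[d' d'0 Hd'].
pose t := Num.min (d / 2) (d' / 2).
have t0 : 0 < t by rewrite lt_min !divr_gt0.
have td : t <= d / 2 by rewrite ge_min lexx.
have td' : t <= d' / 2 by rewrite ge_min lexx orbT.
have Ea : field G (t *: e_ o0 + x0) 0 i = h t * a by rewrite Et// mxE.
have := Hd t; rewrite /ball/= sub0r normrN gtr0_norm// => /(_ ltac:(lra)).
rewrite scale0r add0r Ea => H1.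
have := Hd' t (ltW t0); rewrite subr0 gtr0_norm// h0 sub0r normrN => /(_ ltac:(lra)).
rewrite ltr_pdivlMr// => H2.
have H3 : `|h t * a| <= e / 2.
  rewrite normrM; apply: le_trans (ltW H2); apply: ler_wpM2l => //; lra.
have := ler_normD (field G x0 0 i - h t * a) (h t * a); rewrite subrK; lra.
Qed.

Lemma field_not_standard : ~ standard_form (field G).
Proof.
move=> [x0 [A [h [_ hs _ [h0 _] E]]]]; have x00 := field_standard_center hs h0 E.
have unitE w : nsq w = 1 -> G 1 *: Phi w = h 1 *: (w *m A).
  move=> w1; have w0 : w != 0 by rewrite -nsq_gt0 w1.
  have := E w; rewrite x00 subr0 => /(_ w0); rewrite /field w1.
  have -> : enorm w = 1 by rewrite /enorm -/(nsq w) w1 sqrtr1.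
  have -> : normalize w = w.
    by rewrite /normalize /enorm -/(nsq w) w1 sqrtr1 invr1 scale1r.
  by [].
(* Phi reverses the first and fifth basis vectors but fixes their normalised sum, which no linear
   map can do. *)
pose s : R := Num.sqrt (2^-1); pose w := s *: (e_ o0 + e_ o4).
have s2 : s ^+ 2 = 2^-1 by rewrite sqr_sqrtr// invr_ge0.
have s0 : 0 < s by rewrite sqrtr_gt0 invr_gt0.
have nw : nsq w = 1.
  by rewrite nsqZ s2 nsqE !mxE /=; field.
have E1 := unitE _ (nsq_basis R o0); have E2 := unitE _ (nsq_basis R o4); have E3 := unitE _ nw.
have P1 : Phi (e_ o0) = - e_ o0.
  by apply/rowP; apply: ord6_ind; rewrite mxE phiE !mxE /=; ring.
have P2 : Phi (e_ o4) = - e_ o4.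
  by apply/rowP; apply: ord6_ind; rewrite mxE phiE !mxE /=; ring.
have P3 : Phi w = w.
  have H : Phi (e_ o0 + e_ o4) = 2 *: (e_ o0 + e_ o4).
    by apply/rowP; apply: ord6_ind; rewrite mxE phiE !mxE /=; ring.
  by rewrite PhiZ H scalerA exprS s2 -mulrA mulVf ?mulr1.
have : G 1 *: w = - G 1 *: w.
  rewrite -[in LHS]P3 E3 -scalemxAl scalerA mulrC -scalerA mulmxDl scalerDr -E1 -E2 P1 P2.
  by rewrite /w !scalerN -opprD -scalerDr scalerN scaleNr !scalerA mulrC.
move=> /(congr1 (fun v : V => v 0 o0)); rewrite !mxE /=.
have [_ _ /andP[G0 _] _ _] := factor (ltr01 : 0 < (1 : R)).
have : 0 < G 1 * s by rewrite mulr_gt0.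
lra.
Qed.

End Isoparametric.

(** * The degree *)

Section BlockDeterminant.
Variable R : comNzRingType.

(** Entries are indexed by natural numbers so that the indices of the minors compute under repeated
    expansion along the first row. *)
Definition det_nat (n : nat) (f : nat -> nat -> R) : R := \det (\matrix_(i < n, j < n) f i j).
Arguments det_nat : simpl never.

Lemma expand_det_nat (n : nat) (f : nat -> nat -> R) : det_nat n.+1 f =
  \sum_(k < n.+1) f 0%N k * ((-1) ^+ k * det_nat n (fun i j => f i.+1 (bump k j))).
Proof.
rewrite /det_nat (expand_det_row _ ord0); apply: eq_bigr => k _; rewrite mxE /cofactor add0n.
by congr (_ * (_ * \det _)); apply/matrixP => i j; rewrite !mxE.
Qed.

(** At points of the plane of coordinates 0 and 4 the Jacobian splits into the blocks {0, 4}, {1,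
    3}, {2} and {5}; [swap] exchanges the first two. *)
Definition block_index (i : nat) : nat := nth 0%N [:: 0; 1; 2; 1; 0; 3]%N i.

Lemma det_block6 (f : nat -> nat -> R) :
  (forall i j, (i < 6)%N -> (j < 6)%N -> block_index i != block_index j -> f i j = 0) ->
  det_nat 6 f =
  (f 0%N 0%N * f 4%N 4%N - f 0%N 4%N * f 4%N 0%N) * (f 1%N 1%N * f 3%N 3%N - f 1%N 3%N * f 3%N 1%N) * f 2%N 2%N * f 5%N 5%N.
Proof.
move=> H.
have Z : ((f 0%N 1%N = 0) * (f 0%N 2%N = 0) * (f 0%N 3%N = 0) * (f 0%N 5%N = 0) *
  (f 1%N 0%N = 0) * (f 1%N 2%N = 0) * (f 1%N 4%N = 0) * (f 1%N 5%N = 0) *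
  (f 2%N 0%N = 0) * (f 2%N 1%N = 0) * (f 2%N 3%N = 0) * (f 2%N 4%N = 0) * (f 2%N 5%N = 0) *
  (f 3%N 0%N = 0) * (f 3%N 2%N = 0) * (f 3%N 4%N = 0) * (f 3%N 5%N = 0) *
  (f 4%N 1%N = 0) * (f 4%N 2%N = 0) * (f 4%N 3%N = 0) * (f 4%N 5%N = 0) *
  (f 5%N 0%N = 0) * (f 5%N 1%N = 0) * (f 5%N 2%N = 0) * (f 5%N 3%N = 0) * (f 5%N 4%N = 0))%type.
  by do !split; apply: H.
do 6! rewrite ?expand_det_nat ?big_ord_recl ?big_ord0 /= /bump /= ?Z ?mul0r ?addr0 ?add0r.
by rewrite /det_nat !det_mx00; ring.
Qed.

End BlockDeterminant.

(** * The homogeneous extension of degree 1 of Phi and its differential *)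

Section Differentiability.
Variable R : realType.
Notation V := 'rV[R]_6.
Notation e_ i := (delta_mx 0 i : V).
Implicit Types (x y v w z : V) (i j k : 'I_6).

Lemma df_nsq x : differentiable (@nsq R) x.
Proof.
rewrite (_ : @nsq R = (fun y : V => y 0 o0) ^+ 2 + (fun y : V => y 0 o1) ^+ 2
  + (fun y : V => y 0 o2) ^+ 2 + (fun y : V => y 0 o3) ^+ 2
  + (fun y : V => y 0 o4) ^+ 2 + (fun y : V => y 0 o5) ^+ 2).
  by do ?apply: differentiableD; apply: differentiableX; exact: differentiable_coord.
by apply/funext => y; rewrite nsqE !exprfctE.
Qed.

Lemma df_qf x : differentiable (@qf R) x.
Proof.
rewrite (_ : @qf R = (fun y : V => y 0 o0) ^+ 2 + (fun y : V => y 0 o1) ^+ 2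
  + (fun y : V => y 0 o2) ^+ 2 - (fun y : V => y 0 o3) ^+ 2
  - (fun y : V => y 0 o4) ^+ 2 - (fun y : V => y 0 o5) ^+ 2).
  by do ?apply: differentiableD; do ?apply: differentiableN; apply: differentiableX;
    exact: differentiable_coord.
by apply/funext => y; rewrite /qf qdE !expr2.
Qed.

Lemma df_pf x : differentiable (@pf R) x.
Proof.
pose c i : V -> R := fun y => y 0 i.
have dc i : differentiable (c i) x by exact: differentiable_coord.
rewrite (_ : @pf R = 2 *: (c o0 * c o3 + c o1 * c o4 + c o2 * c o5)).
  by apply: differentiableZ; do ?apply: differentiableD; apply: differentiableM.
apply/funext => y; rewrite /pf pdE /=.
transitivity (2 * (c o0 y * c o3 y + c o1 y * c o4 y + c o2 y * c o5 y)); last by [].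
by rewrite /c; ring.
Qed.

Lemma df_phi i x : differentiable (phi i) x.
Proof.
pose c i : V -> R := fun y => y 0 i.
have dc k : differentiable (c k) x by exact: differentiable_coord.
rewrite (_ : phi i = @nsq R * c i - 2 *: (@qf R * (half_sign R i *: c i) + @pf R * c (swap i)))//.
apply: differentiableB; first by apply: differentiableM => //; exact: df_nsq.
apply: differentiableZ; apply: differentiableD.
  by apply: differentiableM; [exact: df_qf | exact: differentiableZ].
by apply: differentiableM => //; exact: df_pf.
Qed.

(** As Phi is homogeneous of degree 3, its extension of degree 1 is Phi / N: again a radial field,
    to which the earlier derivative formulas apply. *)
Lemma coneE : cone (@Phi R) = field (fun t : R => t^-1).
Proof.
apply/funext => x; rewrite /cone /normalize PhiZ scalerA /field -sqr_enorm.
(* At the origin both scalar factors are 0, by the convention that the inverse of 0 is 0. *)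
have [E|r0] := eqVneq (enorm x) 0; last by congr (_ *: _); field.
by rewrite E mul0r expr0n invr0.
Qed.

Lemma df_cone x : x != 0 -> differentiable (cone (@Phi R)) x.
Proof.
move=> x0; rewrite coneE.
rewrite (_ : field _ = \sum_i (fun y : V => ((fun z => (nsq z)^-1) * phi i) y *: e_ i)).
  apply: differentiable_sum => i; apply: differentiableZl; apply: differentiableM.
    by apply: differentiableV; [exact: df_nsq | rewrite gt_eqF// nsq_gt0].
  exact: df_phi.
apply/funext => y; rewrite fct_sumE; apply/rowP => k; rewrite summxE (bigD1 k)//= big1.
  by rewrite !mxE !eqxx mulr1 addr0.
by move=> i /negbTE ik; rewrite !mxE eqxx/= eq_sym ik mulr0.
Qed.

Lemma cone_derive x v : x != 0 ->
  is_derive x v (cone (@Phi R)) (field1 (fun t : R => t^-1) (fun t => - t ^- 2) v x).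
Proof.
move=> x0; rewrite coneE; apply: field_derive.
have n0 : nsq x != 0 by rewrite gt_eqF// nsq_gt0.
by der; [exact: n0|rewrite mulr1].
Qed.

Lemma cone_jacobian_entry x i j : nsq x = 1 ->
  ('J (cone (@Phi R)) x) i j = dphi j x (e_ i) - 2 * x 0 i * phi j x.
Proof.
move=> x1; have x0 : x != 0 by rewrite -nsq_gt0 x1.
have := deriveEjacobian (e_ i) (df_cone x0); rewrite -rowE => /(congr1 (fun w : V => w 0 j)).
rewrite [in RHS]mxE => <-; have [_ ->] := cone_derive (e_ i) x0.
by rewrite mxE x1 dotp_basis; field.
Qed.

Lemma ct_near (f g : V -> V) x : f x = g x -> (\forall y \near x, f y = g y) ->
  continuous_at x g -> continuous_at x f.
Proof.
move=> fgx fg gc; rewrite /continuous_at fgx; apply: cvg_trans gc.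
apply: (@near_eq_cvg _ _ (nbhs x)); near=> y; have -> : f y = g y by near: y; exact: fg.
by [].
Unshelve. all: by end_near. Qed.

Lemma near_neq0 x : x != 0 -> \forall y \near x, y != 0.
Proof.
move=> x0; have n0 : 0 < nsq x by rewrite nsq_gt0.
have H := (@cvgrPdist_lt _ _ _ (nbhs x) _ (@nsq R) (nsq x)).1 (@ct_nsq _ x) _ n0.
near=> y; have : `|nsq x - nsq y| < nsq x by near: y; exact: H.
by rewrite -nsq_gt0 ltr_norml => /andP[]; lra.
Unshelve. all: by end_near. Qed.

Lemma Phi_sphere w : sphere w -> sphere (Phi w).
Proof.
rewrite /sphere /= => w1; have n1 : nsq w = 1 by rewrite -sqr_enorm w1 expr1n.
by rewrite /enorm -/(nsq _) nsq_Phi n1 expr1n sqrtr1.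
Qed.

Lemma Phi_sphere_C1 : sphere_C1 (@Phi R).
Proof.
split; first exact: Phi_sphere.
move=> i; split=> [x /= x0|x /= x0]; first by have [] := cone_derive (e_ i) x0.
apply: (@ct_near _ (field1 (fun t : R => t^-1) (fun t => - t ^- 2) (e_ i))).
- by rewrite /partial; have [_ ->] := cone_derive (e_ i) x0.
- near=> y; have y0 : y != 0 by near: y; exact: near_neq0.
  by rewrite /partial; have [_ ->] := cone_derive (e_ i) y0.
have n0 : nsq x != 0 by rewrite gt_eqF// nsq_gt0.
apply: ct_field1.
  by ct.
have idc : continuous_at (nsq x) (fun t : R => t) by exact: cvg_id.
by ct; rewrite expf_neq0.
Unshelve. all: by end_near. Qed.

End Differentiability.

(** * Jacobian and preimages over a plane *)

Section Degree.
Variable R : realType.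
Notation V := 'rV[R]_6.
Notation e_ i := (delta_mx 0 i : V).
Implicit Types (x y v w z : V) (i j k : 'I_6).

Definition plane_point (c s : R) : V := c *: e_ o0 + s *: e_ o4.

Lemma plane_pointE c s : let x := plane_point c s in
  (x 0 o0 = c) * (x 0 o1 = 0) * (x 0 o2 = 0) * (x 0 o3 = 0) * (x 0 o4 = s) * (x 0 o5 = 0).
Proof. by rewrite /plane_point; do !split; rewrite !mxE /=; ring. Qed.

Lemma nsq_plane c s : nsq (plane_point c s) = c ^+ 2 + s ^+ 2.
Proof. by rewrite nsqE !plane_pointE; ring. Qed.

(** The block {0, 4} has determinant -3, as Phi triples angles in this plane and reverses
    orientation; {1, 3} contributes 1 - (4 c s)^2, and {2}, {5} together (4 c s)^2 - 3. *)
Lemma cone_jacobian_plane c s : c ^+ 2 + s ^+ 2 = 1 ->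
  cone_jacobian (@Phi R) (plane_point c s) =
  3 * ((4 * (c * s)) ^+ 2 - 3) * ((4 * (c * s)) ^+ 2 - 1).
Proof.
move=> cs1; set x := plane_point c s; have x1 : nsq x = 1 by rewrite nsq_plane.
pose f (i j : nat) : R := ('J (cone (@Phi R)) x) (inord i) (inord j).
have -> : cone_jacobian (@Phi R) x = det_nat 6 f.
  by rewrite /cone_jacobian /det_nat; congr (\det _); apply/matrixP => i j; rewrite [RHS]mxE /f !inord_val.
have x0 := plane_pointE c s; rewrite -/x in x0.
have n0 : nsq x = c ^+ 2 + s ^+ 2 by rewrite nsq_plane.
have q0 : qf x = c ^+ 2 - s ^+ 2 by rewrite /qf qdE !x0; ring.
have p0 : pf x = 0 by rewrite /pf pdE !x0; ring.
have entry i j : ('J (cone (@Phi R)) x) i j = 2 * x 0 i * x 0 j + nsq x * (j == i)%:R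
    - 2 * (2 * (half_sign R i * x 0 i) * (half_sign R j * x 0 j)
    + qf x * (half_sign R j * (j == i)%:R) + 2 * x 0 (swap i) * x 0 (swap j)
    + pf x * (swap j == i)%:R) - 2 * x 0 i * phi j x.
  by rewrite cone_jacobian_entry// /dphi dotp_basis qd_basis pd_basis !basisE.
have fE (i j : 'I_6) : f i j = ('J (cone (@Phi R)) x) i j by rewrite /f !inord_val.
have phi_x : (phi o0 x = (3 * s ^+ 2 - c ^+ 2) * c) * (phi o1 x = 0) * (phi o2 x = 0) *
    (phi o3 x = 0) * (phi o4 x = (3 * c ^+ 2 - s ^+ 2) * s) * (phi o5 x = 0).
  by do !split; rewrite phiE !x0; ring.
have Z i j : block_index i != block_index j -> ('J (cone (@Phi R)) x) i j = 0.
  elim/ord6_ind: i; elim/ord6_ind: j => //= _; rewrite entry !swapE !x0 ?phi_x p0 /half_sign /=; ring.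
rewrite det_block6; last first.
  by move=> i j i6 j6 ij; rewrite (fE (Ordinal i6) (Ordinal j6)); exact: Z.
rewrite (fE o0 o0) (fE o4 o4) (fE o0 o4) (fE o4 o0) (fE o1 o1) (fE o3 o3) (fE o1 o3)
  (fE o3 o1) (fE o2 o2) (fE o5 o5) !entry !swapE !x0 !phi_x p0 q0 n0 /half_sign /=.
(* The block {0, 4} becomes homogeneous by inserting factors c^2 + s^2 = 1. *)
have hom (a b : R) : a - b = a * (c ^+ 2 + s ^+ 2) - b by rewrite cs1 mulr1.
transitivity (((3 * (s ^+ 2 - c ^+ 2) - 2 * c * ((3 * s ^+ 2 - c ^+ 2) * c))
  * (3 * (c ^+ 2 - s ^+ 2) - 2 * s * ((3 * c ^+ 2 - s ^+ 2) * s))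
  - (6 * c * s - 2 * c * ((3 * c ^+ 2 - s ^+ 2) * s))
  * (6 * c * s - 2 * s * ((3 * s ^+ 2 - c ^+ 2) * c)))
  * ((c ^+ 2 + s ^+ 2) ^+ 2 - (4 * (c * s)) ^+ 2)
  * ((4 * (c * s)) ^+ 2 - 3 * (c ^+ 2 + s ^+ 2) ^+ 2)); first by ring.
rewrite (hom (3 * (s ^+ 2 - c ^+ 2))) (hom (3 * (c ^+ 2 - s ^+ 2))) !(hom (6 * c * s)).
transitivity (- 3 * (c ^+ 2 + s ^+ 2) ^+ 4 * ((c ^+ 2 + s ^+ 2) ^+ 2 - (4 * (c * s)) ^+ 2)
  * ((4 * (c * s)) ^+ 2 - 3 * (c ^+ 2 + s ^+ 2) ^+ 2)); first by ring.
by rewrite cs1; ring.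
Qed.

(** For given A, B, p the equations are linear systems in the pairs (x0, x3), (x1, x4), (x2, x5),
    with common determinant D up to sign conventions. D = 0 would force A = B = 0, against A + B =
    2, so Cramer's formulas determine the point once p = 0 is known. *)
Lemma plane_preimage (a b : R) x : a != 0 -> b != 0 -> a ^+ 2 != b ^+ 2 -> nsq x = 1 ->
  Phi x = plane_point a b ->
  exists c s, [/\ x = plane_point c s, c ^+ 2 + s ^+ 2 = 1,
    3 * c - 4 * c ^+ 3 = a & (4 * c ^+ 2 - 1) * s = b].
Proof.
move=> a0 b0 ab n1 Px; have co i : phi i x = plane_point a b 0 i by rewrite -Px mxE.
have n1' := n1; rewrite nsqE in n1'.
have c0 := co o0; have c1 := co o1; have c2 := co o2.
have c3 := co o3; have c4 := co o4; have c5 := co o5.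
rewrite phiE plane_pointE in c0; rewrite phiE plane_pointE in c1.
rewrite phiE plane_pointE in c2; rewrite phiE plane_pointE in c3.
rewrite phiE plane_pointE in c4; rewrite phiE plane_pointE in c5.
have back c s : c = x 0 o0 -> s = x 0 o4 -> x 0 o1 = 0 -> x 0 o2 = 0 -> x 0 o3 = 0 ->
    x 0 o5 = 0 -> x = plane_point c s.
  by move=> -> -> y1 y2 y3 y5; apply/rowP; apply: ord6_ind; rewrite plane_pointE.
move: (x 0 o0) (x 0 o1) (x 0 o2) (x 0 o3) (x 0 o4) (x 0 o5) n1' c0 c1 c2 c3 c4 c5 back.
move=> x0 x1 x2 x3 x4 x5.
set A := 3 * (x3 ^+ 2 + x4 ^+ 2 + x5 ^+ 2) - (x0 ^+ 2 + x1 ^+ 2 + x2 ^+ 2).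
set B := 3 * (x0 ^+ 2 + x1 ^+ 2 + x2 ^+ 2) - (x3 ^+ 2 + x4 ^+ 2 + x5 ^+ 2).
set p := x0 * x3 + x1 * x4 + x2 * x5.
move=> {}n1 E0 E1 E2 E3 E4 E5 back.
have AB : A + B = 2 by move: n1; rewrite /A /B; lra.
pose D := A * B - 16 * p ^+ 2.
have D0 : D * x0 = a * B.
  have -> : D * x0 = B * (A * x0 - 4 * p * x3) + 4 * p * (B * x3 - 4 * p * x0) by rewrite /D; ring.
  by rewrite E0 E3; ring.
have D3 : D * x3 = 4 * p * a.
  have -> : D * x3 = A * (B * x3 - 4 * p * x0) + 4 * p * (A * x0 - 4 * p * x3) by rewrite /D; ring.
  by rewrite E0 E3; ring.
have D1 : D * x1 = 4 * p * b.
  have -> : D * x1 = B * (A * x1 - 4 * p * x4) + 4 * p * (B * x4 - 4 * p * x1) by rewrite /D; ring.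
  by rewrite E1 E4; ring.
have D4 : D * x4 = b * A.
  have -> : D * x4 = A * (B * x4 - 4 * p * x1) + 4 * p * (A * x1 - 4 * p * x4) by rewrite /D; ring.
  by rewrite E1 E4; ring.
have D2 : D * x2 = 0.
  have -> : D * x2 = B * (A * x2 - 4 * p * x5) + 4 * p * (B * x5 - 4 * p * x2) by rewrite /D; ring.
  by rewrite E2 E5; ring.
have D5 : D * x5 = 0.
  have -> : D * x5 = A * (B * x5 - 4 * p * x2) + 4 * p * (A * x2 - 4 * p * x5) by rewrite /D; ring.
  by rewrite E2 E5; ring.
have Dn0 : D != 0.
  apply/eqP => DD; move: D0 D4; rewrite DD !mul0r => /esym/eqP; rewrite mulf_eq0 (negbTE a0)/=.
  move=> /eqP B0 /esym/eqP; rewrite mulf_eq0 (negbTE b0)/= => /eqP A0.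
  by move: AB; rewrite A0 B0; lra.
have x20 : x2 = 0 by apply/(mulfI Dn0); rewrite D2 mulr0.
have x50 : x5 = 0 by apply/(mulfI Dn0); rewrite D5 mulr0.
pose S := a ^+ 2 * B + b ^+ 2 * A.
(* If p is nonzero, inserting Cramer's formulas into p gives D^2 = 4 S. Inserting them into the two
   partial norms then gives S = - b^2 D and S = - a^2 D, impossible when a^2 and b^2 differ. *)
have p0 : p = 0.
  apply/eqP; apply: contraT => pn0.
  have DS : D ^+ 2 = 4 * S.
    apply/(mulfI pn0); transitivity ((D * x0) * (D * x3) + (D * x1) * (D * x4)).
      by rewrite /p x20 x50; ring.
    by rewrite D0 D1 D3 D4 /S; ring.
  have X4 : 4 * (x0 ^+ 2 + x1 ^+ 2) = B + 1 by move: n1; rewrite /B x20 x50; lra.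
  have Y4 : 4 * (x3 ^+ 2 + x4 ^+ 2) = A + 1 by move: n1; rewrite /A x20 x50; lra.
  have H1 : S * (B + 1) = S * B - b ^+ 2 * D.
    rewrite -X4 mulrA [S * 4]mulrC -DS mulrDr -!exprMn D0 D1 /S /D; ring.
  have H2 : S * (A + 1) = S * A - a ^+ 2 * D.
    rewrite -Y4 mulrA [S * 4]mulrC -DS mulrDr -!exprMn D3 D4 /S /D; ring.
  have : (a ^+ 2 - b ^+ 2) * D = 0.
    transitivity ((S * (A + 1) - (S * A - a ^+ 2 * D)) - (S * (B + 1) - (S * B - b ^+ 2 * D))).
      by ring.
    by rewrite H1 H2; ring.
  by move/eqP; rewrite mulf_eq0 subr_eq0 (negbTE ab) (negbTE Dn0).
have x30 : x3 = 0 by apply/(mulfI Dn0); rewrite D3 p0 !mulr0 mul0r.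
have x10 : x1 = 0 by apply/(mulfI Dn0); rewrite D1 p0 !mulr0 mul0r.
have n1' : x0 ^+ 2 + x4 ^+ 2 = 1 by move: n1; rewrite x10 x20 x30 x50; lra.
exists x0, x4; split=> //.
- exact: back.
- have x4E : x4 ^+ 2 = 1 - x0 ^+ 2 by move: n1'; lra.
  by rewrite -E0 /A x10 x20 x30 x50 x4E; ring.
- have x4E : x4 ^+ 2 = 1 - x0 ^+ 2 by move: n1'; lra.
  by rewrite -E4 /B x10 x20 x30 x50 x4E; ring.
Qed.

End Degree.

(** * A regular value with three explicit preimages *)

Section DegreeOne.
Variable R : realType.
Notation V := 'rV[R]_6.
Implicit Types (x y v w z : V).

Let w : R := Num.sqrt 3.

Let w2 : w ^+ 2 = 3. Proof. by rewrite sqr_sqrtr. Qed.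

(** The image of the point with cosine 1/7 and sine 4 sqrt 3 / 7. Rotations by 2 pi / 3 preserve
    rational cosines together with sines rational over sqrt 3, so all three preimages are explicit;
    their cosines are the roots of 3 c - 4 c^3 = 143 / 343. *)
Definition target : V := plane_point (143 / 343) (- (180 / 343) * w).

(* On the plane spanned by the first and fifth basis vectors Phi maps the angle t
   to pi - 3 t, so that the preimages of a point of that circle differ by 2 pi / 3. *)
Definition preimage1 : V := plane_point (2 / 14) (8 / 14 * w).
Definition preimage2 : V := plane_point (11 / 14) (- (5 / 14) * w).
Definition preimage3 : V := plane_point (- (13 / 14)) (- (3 / 14) * w).

Lemma Phi_plane c s :
  Phi (plane_point c s : V) = plane_point ((3 * s ^+ 2 - c ^+ 2) * c) ((3 * c ^+ 2 - s ^+ 2) * s).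
Proof.
by apply/rowP; apply: ord6_ind; rewrite mxE phiE !plane_pointE; ring.
Qed.

Lemma sphereE x : sphere x <-> nsq x = 1.
Proof.
rewrite /sphere /= -sqr_enorm; split=> [->|]; first by rewrite expr1n.
by move=> /eqP; rewrite sqrp_eq1 ?enorm_ge0// => /eqP.
Qed.

Lemma preimage1_norm : (2 / 14) ^+ 2 + (8 / 14 * w) ^+ 2 = 1.
Proof. by have := w2; lra. Qed.

Lemma preimage2_norm : (11 / 14) ^+ 2 + (- (5 / 14) * w) ^+ 2 = 1.
Proof. by have := w2; lra. Qed.

Lemma preimage3_norm : (- (13 / 14)) ^+ 2 + (- (3 / 14) * w) ^+ 2 = 1.
Proof. by have := w2; lra. Qed.

Lemma target_norm : (143 / 343) ^+ 2 + (- (180 / 343) * w) ^+ 2 = 1.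
Proof. by have := w2; lra. Qed.

Lemma Phi_preimage (c d : R) : (3 * (d ^+ 2 * 3) - c ^+ 2) * c = 143 / 343 ->
  (3 * c ^+ 2 - d ^+ 2 * 3) * d = - (180 / 343) -> Phi (plane_point c (d * w)) = target.
Proof. by move=> E1 E2; rewrite Phi_plane exprMn w2 E1 mulrA E2. Qed.

Lemma preimages : [set x : V | sphere x /\ Phi x = target] =
  [set` [:: preimage1; preimage2; preimage3]].
Proof.
apply/seteqP; split=> x /=; rewrite !inE.
  move=> [/sphereE n1 Px].
  have w_gt0 : 0 < w by rewrite sqrtr_gt0.
  have [|||c [s [-> cs E1 E2]]] := plane_preimage _ _ _ n1 Px.
  - by apply/eqP; lra.
  - by apply/eqP => E; lra.
  - by apply/eqP => E; have := w2; lra.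
  have : (c - 2 / 14) * (c - 11 / 14) * (c + 13 / 14) = 0 by lra.
  move/eqP; rewrite !mulf_eq0 !subr_eq0 addr_eq0 -orbA => /or3P[]/eqP cE; subst c.
  - have -> : s = 8 / 14 * w by lra.
    by rewrite eqxx.
  - have -> : s = - (5 / 14) * w by lra.
    by rewrite eqxx orbT.
  - have -> : s = - (3 / 14) * w by lra.
    by rewrite eqxx !orbT.
move=> /or3P[]/eqP ->; split.
- by apply/sphereE; rewrite nsq_plane preimage1_norm.
- by apply: Phi_preimage; lra.
- by apply/sphereE; rewrite nsq_plane preimage2_norm.
- by apply: Phi_preimage; lra.
- by apply/sphereE; rewrite nsq_plane preimage3_norm.
- by apply: Phi_preimage; lra.
Qed.

Lemma cone_jacobian_preimage (c d : R) : c ^+ 2 + (d * w) ^+ 2 = 1 ->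
  cone_jacobian (@Phi R) (plane_point c (d * w)) =
  3 * ((4 * (c * d)) ^+ 2 * 3 - 3) * ((4 * (c * d)) ^+ 2 * 3 - 1).
Proof.
move=> cs; rewrite cone_jacobian_plane//.
have -> : (4 * (c * (d * w))) ^+ 2 = (4 * (c * d)) ^+ 2 * 3 by rewrite -w2; ring.
by [].
Qed.

Lemma jacobian1 : 0 < cone_jacobian (@Phi R) preimage1.
Proof. by rewrite cone_jacobian_preimage ?preimage1_norm//; lra. Qed.

Lemma jacobian2 : 0 < cone_jacobian (@Phi R) preimage2.
Proof. by rewrite cone_jacobian_preimage ?preimage2_norm//; lra. Qed.

Lemma jacobian3 : cone_jacobian (@Phi R) preimage3 < 0.
Proof. by rewrite cone_jacobian_preimage ?preimage3_norm//; lra. Qed.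

Lemma preimages_uniq : uniq [:: preimage1; preimage2; preimage3].
Proof.
have H (a b c d : R) : a != c -> plane_point a b != plane_point c d.
  by apply: contra_neq => /(congr1 (fun x : V => x 0 o0)); rewrite !plane_pointE.
by rewrite /= !inE !negb_or !H//; apply/eqP; lra.
Qed.

Lemma Phi_homotopic (f : V -> V) : (forall w, sphere w -> f w = Phi w) ->
  sphere_homotopic f (@Phi R).
Proof.
move=> fE; exists (fun p => Phi p.2); split=> //=.
- apply: continuous_subspaceT => p; apply: (@cvg_comp _ _ _ snd (@Phi R) _ (nbhs p.2)).
    exact: cvg_snd.
  apply: continuous_row => i; rewrite (_ : (fun y => _) = phi i); first exact: ct_phi.
  by apply/funext => y; rewrite mxE.
- by move=> t v _; exact: Phi_sphere.
- by move=> v /fE.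
Qed.

Lemma degree_Phi (f : V -> V) : (forall w, sphere w -> f w = Phi w) -> brouwer_degree f 1.
Proof.
move=> fE; exists (@Phi R), target; split.
- exact: Phi_homotopic.
- exact: Phi_sphere_C1.
- split; first by apply/sphereE; rewrite nsq_plane target_norm.
  move=> x sx Px; have : [set x : V | sphere x /\ Phi x = target] x by [].
  rewrite preimages /= !inE => /or3P[]/eqP ->.
  + by rewrite gt_eqF// jacobian1.
  + by rewrite gt_eqF// jacobian2.
  + by rewrite lt_eqF// jacobian3.
- by rewrite preimages; exact: finite_seq.
rewrite preimages -fsbig_seq ?preimages_uniq// !big_cons big_nil.
transitivity (1 + (1 + (-1 + 0)) : int); last by [].
congr (_ + (_ + (_ + _))).
- exact: gtr0_sgz jacobian1.
- exact: gtr0_sgz jacobian2.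
- exact: ltr0_sgz jacobian3.
Qed.

(** Normalising the field on a sphere of any radius r > 0 gives exactly Phi, since the scalar factor
    r^3 G(r^2) is positive. *)
Lemma field_degree (G G1 : R -> R) : radial_factor G G1 -> degree_at_infinity (field G) 1.
Proof.
move=> factor; exists 0; split; first exact: num_real.
move=> r r0; apply: degree_Phi => v sv.
have v1 : enorm v = 1 by exact: sv.
have n1 : nsq v = 1 by apply/sphereE.
have P1 : enorm (Phi v) = 1 by exact: Phi_sphere sv.
have [_ _ /andP[G0 _] _ _] := factor _ (exprn_gt0 2 r0).
rewrite /field nsqZ n1 mulr1 PhiZ scalerA.
have c0 : 0 < G (r ^+ 2) * r ^+ 3 by rewrite mulr_gt0 ?exprn_gt0.
move: (G _ * _) c0 => c c0; rewrite /normalize.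
have -> : enorm (c *: Phi v) = c.
  have : enorm (c *: Phi v) ^+ 2 = c ^+ 2 by rewrite sqr_enorm nsqZ -sqr_enorm P1 expr1n mulr1.
  by move=> /eqP; rewrite eqrXn2 ?enorm_ge0 ?ltW// => /eqP.
by rewrite scalerA mulVf ?scale1r// gt_eqF.
Qed.

End DegreeOne.

Theorem theorem1p2 (R : realType) :
  exists u : 'rV[R]_6 -> 'rV[R]_6,
  [/\ ginzburg_landau u,
      norm_tends_to_1 u,
      degree_at_infinity u 1,
      ~ standard_form u
    & exists h : R -> R,
      [/\ radial_profile h,
          forall k : R -> R, radial_profile k -> forall r, 0 <= r -> k r = h r
        & forall x, x != 0 ->
            u x = h (enorm x) *: isoparam_gradient_map (normalize x)]].
Proof.
have [G [G1 factor]] := radial_factor_exists R.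
exists (field G); split.
- exact: field_ginzburg_landau factor.
- exact: field_norm_tends_to_1 factor.
- exact: field_degree factor.
- exact: field_not_standard factor.
exists (profile_of G); split.
- exact: profile_of_radial factor.
- exact: profile_of_unique factor.
- exact: field_radial.
Qed.
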